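(* Let $\alpha\ge0$, $1\le s\le\infty$, $1\le p\le\infty$, $\mu>0$ (with $1/\infty=0$), and let $\bar c=\frac{0.7039}{\Gamma(\alpha+1)}\,12^{-\alpha/2}$. The assumption $\mu>1-1/s$ is the exact threshold at which the quantities $\varepsilon_N(W^\mu_s)$ and $R_{N,\delta}(W^\mu_s,\Psi_N,C,\ell_p)$ are finite. Namely: (a) For every integer $N\ge1$ and every integer $M>N$, the function $f_1(t)=2^{-\mu}M^{-\mu-1/s}\sum_{k=M}^{2M-1}\ell_k^{(\alpha)}(t)$ satisfies $$\varepsilon_N(W^\mu_s)\ \ge\ \|f_1\sqrt w\|_C\ \ge\ 2^{-\mu}\,\bar c\,M^{-\mu-1/s+1}.$$ Consequently, if $\mu<1-1/s$, then $\varepsilon_N(W^\mu_s)$ is infinite for every $N$; if $\mu=1-1/s$, then $\varepsilon_N(W^\mu_s)\ge2^{-\mu}\bar c>0$ for every $N$, so that the Fourier method $S_N$ does not converge on $W^\mu_s$. (b) There is a constant $c>0$, independent of $N$, $M$ and $\delta$, such that for every integer $N\ge1$, every $0<\delta<1$ and every integer $M\ge N$, $$R_{N,\delta}(W^\mu_s,\Psi_N,C,\ell_p)\ \ge\ c\,M^{-\mu-1/s+1}.$$ Consequently, if $\mu<1-1/s$, then $R_{N,\delta}(W^\mu_s,\Psi_N,C,\ell_p)$ is infinite for all $N$ and $\delta$; if $\mu=1-1/s$, then it is bounded away from zero uniformly in $N$ and $\delta$. Thus the condition $\mu>1-1/s$ describes exactly the range of parameters in which the considered problem (recovery, in the weighted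 sup-norm, of functions $f\in W^\mu_s$ from Fourier–Laguerre coefficients perturbed by at most $\delta$ in $\ell_p$) has a finite answer vanishing as $\delta\to0$.
   Context: Let $w(t)=t^\alpha e^{-t}$ on $(0,\infty)$, and let $L_{2,w}$ be the real Hilbert space of functions square-summable on $(0,\infty)$ with weight $w$, with $\langle f,g\rangle=\int_0^\infty t^\alpha e^{-t}f(t)g(t)\,dt$. The Laguerre polynomials are $L_k^{(\alpha)}(t)=\sum_{m=0}^k\frac{\Gamma(k+\alpha+1)}{\Gamma(m+\alpha+1)(k-m)!}\frac{(-t)^m}{m!}$, and $\ell_k^{(\alpha)}=\left(\frac{k!}{\Gamma(k+\alpha+1)}\right)^{1/2}L_k^{(\alpha)}$, $k\in\mathbb N_0=\{0,1,2,\dots\}$, is the corresponding orthonormal system in $L_{2,w}$. $C$ is the space of real-valued functions continuous on $(0,\infty)$, and for $g\in C$ one puts $\|g\|_C=\sup_{t>0}|g(t)|\in[0,+\infty]$; this quantity is used only for weighted functions $g=h\sqrt w$, for which it is finite. $\ell_p$, $1\le p\le\infty$, is the usual space of sequences indexed by $\mathbb N_0$. For $f\in L_{2,w}$, $\mathbf f=(\langle f,\ell_k^{(\alpha)}\rangle)_{k\in\mathbb N_0}\in\ell_2$ is its sequence of Fourier–Laguerre coefficients. With $\underline k=\max\{1,k\}$, put $\|f\|_{s,\mu}^s=\sum_{k=0}^\infty\underline k^{s\mu}|\langle f,\ell_k^{(\alpha)}\rangle|^s$ for $1\le s<\infty$ and $\|f\|_{\infty,\mu}=\sup_{k\in\mathbb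 N_0}\underline k^\mu|\langle f,\ell_k^{(\alpha)}\rangle|$. The function class is $W^\mu_s=\{f\in L_{2,w}:\|f\|_{s,\mu}\le1\}$. The Fourier method is $S_Nf=\sum_{k=0}^N\langle f,\ell_k^{(\alpha)}\rangle\ell_k^{(\alpha)}$, and $\varepsilon_N(W^\mu_s)=\sup_{\|f\|_{s,\mu}\le1}\|(f-S_Nf)\sqrt w\|_C$. For a finite set $\Omega\subset\mathbb N_0$, $G_\Omega:L_{2,w}\to\ell_2$ maps $f$ to the sequence whose $k$-th entry is $\langle f,\ell_k^{(\alpha)}\rangle$ if $k\in\Omega$ and $0$ otherwise. A recovery operator is any mapping $\psi:\ell_2\to C$. $\Psi_N$ is the set of all compositions $\psi G_\Omega$ with $\operatorname{card}(\Omega)\le N$. For such a method, $$e_\delta(W^\mu_s,\psi G_\Omega,C,\ell_p)=\sup_{f\in W^\mu_s}\ \sup_{f^\delta\in L_{2,w}:\ \|\mathbf f^\delta-\mathbf f\|_{\ell_p}\le\delta}\|(f-\psi G_\Omega(f^\delta))\sqrt w\|_C,$$ where $\mathbf f^\delta$ is the Fourier–Laguerre coefficient sequence of $f^\delta$, and $$R_{N,\delta}(W^\mu_s,\Psi_N,C,\ell_p)=\inf_{\psi G_\Omega\in\Psi_N}e_\delta(W^\mu_s,\psi G_\Omega,C,\ell_p).$$ *)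

(* Defs.v *)
From HB Require Import structures.
From mathcomp Require Import all_boot all_order all_algebra finmap.
From mathcomp Require Import all_classical all_reals all_analysis.

Set Implicit Arguments.
Unset Strict Implicit.
Unset Printing Implicit Defensive.

Import Order.TTheory GRing.Theory Num.Theory.
Import numFieldNormedType.Exports.

Local Open Scope classical_set_scope.
Local Open Scope ring_scope.

Section FourierLaguerre.
Variable R : realType.
Implicit Types (alpha mu delta t : R) (s p v : \bar R) (N M k : nat).
Implicit Types (f g h : R -> R) (a : nat -> R).
Implicit Types (psi : (nat -> R) -> (R -> R)) (Omega : {fset nat}).

Local Notation leb := (@lebesgue_measure R).

Definition halfline : set R := `]0, +oo[%classic.

Definition Gamma (x : R) : R :=
  Rintegral leb halfline (fun t => t `^ (x - 1) * expR (- t)).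

Definition weight alpha t : R := t `^ alpha * expR (- t).

Definition sqrtw alpha t : R := Num.sqrt (weight alpha t).

(* Elements of L_{2,w} are represented by functions; only the restriction to
   (0, +oo) matters, and everything below is invariant under modification on
   a Lebesgue-null set. *)
Definition L2w alpha : set (R -> R) := [set f : R -> R |
  measurable_fun halfline f /\
  (\int[leb]_(t in halfline) (weight alpha t * f t ^+ 2)%:E < +oo)%E].

Definition dotw alpha f g : R :=
  Rintegral leb halfline (fun t => weight alpha t * f t * g t).

Definition Laguerre alpha k t : R :=
  \sum_(m < k.+1)
    Gamma (k%:R + alpha + 1) / (Gamma (m%:R + alpha + 1) * (k - m)`!%:R)
    * ((- t) ^+ m / m`!%:R).

Definition ell alpha k t : R :=
  Num.sqrt (k`!%:R / Gamma (k%:R + alpha + 1)) * Laguerre alpha k t.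

Definition coef alpha f k : R := dotw alpha f (ell alpha k).

Definition lnorm p a : \bar R := Lnorm counting p (EFin \o a).

(* 1 / s, with 1 / oo = 0 *)
Definition recip s : R := fine (s^-1)%E.

(* The value at s = -oo is irrelevant. *)
Definition smnorm alpha s mu f : \bar R :=
  match s with
  | r%:E => ((\sum_(0 <= k <oo)
      ((maxn 1 k)%:R `^ (r * mu) * `|coef alpha f k| `^ r)%:E) `^ r^-1)%E
  | +oo%E => ereal_sup
      (range (fun k => ((maxn 1 k)%:R `^ mu * `|coef alpha f k|)%:E))
  | -oo%E => 0%E
  end.

Definition W alpha s mu : set (R -> R) :=
  [set f : R -> R | L2w alpha f /\ (smnorm alpha s mu f <= 1)%E].

Definition inC h : Prop := forall t, 0 < t -> {for t, continuous h}.

Definition normC h : \bar R := ereal_sup [set `|h t|%:E | t in halfline].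

Definition Crepr g h : Prop :=
  inC h /\ {ae leb, forall t, 0 < t -> g t = h t}.

(* ||g||_C for an almost-everywhere class g: the supremum norm of its
   continuous representative, which is unique on (0, +oo).  A class without
   continuous representative lies outside C, where the norm is not defined;
   it gets the value v.  With v = +oo this extends the norm by +oo outside C;
   with v = 0 such a class does not contribute to a supremum of norms. *)
Definition normCext v g : \bar R :=
  match pselect (exists h, Crepr g h) with
  | left e => normC (sval (cid e))
  | right _ => v
  end.

Definition wnorm alpha v g : \bar R :=
  normCext v (g \* sqrtw alpha).

Definition fourier_sum alpha N f t : R :=
  \sum_(k < N.+1) coef alpha f k * ell alpha k t.

Definition eps alpha v s mu N : \bar R :=
  ereal_sup [set wnorm alpha v (f \- fourier_sum alpha N f)
            | f in W alpha s mu].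

Definition Ginfo alpha Omega f : nat -> R :=
  fun k => if k \in Omega then coef alpha f k else 0.

Definition ell2 : set (nat -> R) := [set a : nat -> R | (lnorm 2%:E a < +oo)%E].

Definition recovery psi : Prop :=
  forall a, ell2 a -> inC (psi a).

Definition err alpha v s mu p delta psi Omega : \bar R :=
  ereal_sup [set
    ereal_sup [set wnorm alpha v (f \- psi (Ginfo alpha Omega fd))
      | fd in [set fd : R -> R | L2w alpha fd /\
          (lnorm p (fun k => coef alpha fd k - coef alpha f k)%R
             <= delta%:E)%E]]
    | f in W alpha s mu].

Definition Rmin alpha v s mu p N delta : \bar R :=
  ereal_inf [set e | exists psi Omega,
    [/\ recovery psi, (#|` Omega| <= N)%N
      & e = err alpha v s mu p delta psi Omega]].

Definition cbar alpha : R :=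
  7039 / 10000 / Gamma (alpha + 1) * 12 `^ (- (alpha / 2)).

Definition f1 alpha s mu M t : R :=
  2 `^ (- mu) * M%:R `^ (- mu - recip s)
  * \sum_(M <= k < M.*2) ell alpha k t.

End FourierLaguerre.

(* Main.v *)
Require Import Defs.
From HB Require Import structures.
From mathcomp Require Import all_boot all_order all_algebra finmap.
From mathcomp Require Import all_classical all_reals all_analysis.
From mathcomp Require Import measurable_realfun ess_sup_inf ring lra zify.
Set Implicit Arguments.
Unset Strict Implicit.
Unset Printing Implicit Defensive.
Import Order.TTheory GRing.Theory Num.Theory.
Import numFieldNormedType.Exports.
Local Open Scope classical_set_scope.
Local Open Scope ring_scope.

(* The Laguerre functions [ell k * sqrt w] are bounded on (0, +oo) uniformly in
    [k].  For t of order 1/k this follows from the explicit formula.  For larger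
    t up to 2k + alpha + 2 put S = w (ell_(k+1)^2 + ell_k^2) and let V be the
    primitive of S: the first order system satisfied by (ell_(k+1), ell_k)
    provides a quadratic form H with H' = w ell_(k+1) ell_k <= V'/2, so H <= V/2,
    which bounds S by V/t up to constants and makes V/t essentially
    nonincreasing.  Beyond, the derivative of w ell_(k+1)^2 is bounded below by
    -3S/2, and S has integral 2.

    The Laguerre system is complete: a function in L_{2,w} orthogonal to all
    polynomials, multiplied by w, has a Laplace transform which vanishes at 0
    with all its derivatives, hence, by steps of length 1/4, on [0, +oo); its
    integrals over the half-lines ]c, +oo[ then vanish as well.  For
    mu > 1 - 1/s, Young's inequality bounds the tails of the coefficients by a
    negative power of N, so the Laguerre series converges uniformly to the
    continuous representative; keeping N noisy coefficients costs a further
    multiple of N delta.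

    Lower bounds come from blocks of about M functions ell_k with k of order M,
    all of which are bounded below by a multiple of (k t)^(alpha/2) near
    t = 1/(12 M).  For the recovery problem the block avoids Omega, so that a
    block and its opposite have the same information. *)

(** Elements of the class are almost-everywhere classes, and with [v = +oo] one without continuous
    representative has infinite norm. Finite upper bounds thus need such a representative for every
    f in the class: uniform convergence of the Laguerre series yields a continuous function, and
    completeness identifies it with f. In the lower bounds every function measured is continuous, so
    [v] does not matter there. No asymptotic formula is used for the uniform bound. A single
    Laguerre function oscillates, but a consecutive pair obeys a Hamiltonian system in the variable
    log t whose coefficients drift slowly, so its energy can be followed. Boundedness without any
    decay in k is enough, because it reduces the convergence question to summability of the
    coefficients, and mu > 1 - 1/s is the condition for that. Moments do not determine a function on
    the half-line in general; here the weight leaves a spare factor e^(t/4), which lets the Laplace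
    transform be expanded into moments with a step length that does not shrink. *)

Section Halfline.
Context {R : realType}.
Implicit Types (a b c t x : R) (f g : R -> R) (n : nat).
Local Notation leb := (@lebesgue_measure R).
Local Notation D := (@halfline R).

(** * Integration over the half-line and the weights t^b e^(-t) *)

Lemma halflineP t : D t <-> 0 < t.
Proof. by rewrite /halfline /= in_itv/= andbT. Qed.

Let mD : @measurable _ (measurableTypeR R) D.
Proof. exact: measurable_itv. Qed.

Let mEFin f : measurable_fun D f ->
  @measurable_fun _ _ (measurableTypeR R) _ D (EFin \o f).
Proof. by move=> mf; exact: ((measurable_EFinP _ _).2 mf). Qed.

Definition hl_integrable f : Prop := leb.-integrable D (EFin \o f).

Lemma hl_integrable_measurable f : hl_integrable f -> measurable_fun D f.
Proof. by move=> /(measurable_int leb) /measurable_EFinP. Qed.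

Lemma hl_integrable_le f g : measurable_fun D f -> (forall t, 0 < t -> `|f t| <= g t) ->
  hl_integrable g -> hl_integrable f.
Proof.
move=> mf fg ig; apply: le_integrable ig; first exact: mD.
  exact: mEFin.
by move=> t /halflineP t0 /=; rewrite lee_fin (le_trans (fg _ t0))// ler_norm.
Qed.

Lemma eq_hl_integrable f g : (forall t, 0 < t -> f t = g t) -> hl_integrable f -> hl_integrable g.
Proof.
move=> fg; apply: eq_integrable; first exact: mD.
by move=> t /set_mem /halflineP t0; rewrite /= fg.
Qed.

Lemma hl_integrableD f g : hl_integrable f -> hl_integrable g -> hl_integrable (f \+ g).
Proof. by move=> hf hg; exact: (integrableD mD hf hg). Qed.

Lemma hl_integrableB f g : hl_integrable f -> hl_integrable g -> hl_integrable (f \- g).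
Proof. by move=> hf hg; exact: (integrableB mD hf hg). Qed.

Lemma hl_integrableZ c f : hl_integrable f -> hl_integrable (fun t => c * f t).
Proof. by move=> hf; exact: (integrableZl mD c hf). Qed.

Lemma hl_integrable_norm f : hl_integrable f -> hl_integrable (fun t => `|f t|).
Proof. exact: integrable_norm. Qed.

Lemma hl_integrable0 : hl_integrable (fun=> 0).
Proof. exact: integrable0. Qed.

Lemma hl_integrable_sum (I : Type) (r : seq I) (F : I -> R -> R) :
  (forall i, hl_integrable (F i)) -> hl_integrable (fun t => \sum_(i <- r) F i t).
Proof.
move=> h; elim: r => [|i r IH].
  by apply: eq_hl_integrable hl_integrable0 => t _; rewrite big_nil.
by apply: eq_hl_integrable (hl_integrableD (h i) IH) => t _; rewrite big_cons.
Qed.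

Definition hl_int f : R := Rintegral leb D f.

Lemma hl_intE f : hl_int f = Rintegral leb D f. Proof. by []. Qed.

Lemma eq_hl_int f g : (forall t, 0 < t -> f t = g t) -> hl_int f = hl_int g.
Proof. by move=> fg; apply: eq_Rintegral => t /set_mem /halflineP /fg. Qed.

Lemma hl_intD f g : hl_integrable f -> hl_integrable g -> hl_int (fun t => f t + g t) = hl_int f + hl_int g.
Proof. by move=> hf hg; exact: (RintegralD mD hf hg). Qed.

Lemma hl_intB f g : hl_integrable f -> hl_integrable g -> hl_int (fun t => f t - g t) = hl_int f - hl_int g.
Proof. by move=> hf hg; exact: (RintegralB mD hf hg). Qed.

Lemma hl_intZ c f : hl_integrable f -> hl_int (fun t => c * f t) = c * hl_int f.
Proof. by move=> hf; exact: (RintegralZl c mD hf). Qed.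

Lemma hl_int_le f g : hl_integrable f -> hl_integrable g -> (forall t, 0 < t -> f t <= g t) ->
  hl_int f <= hl_int g.
Proof.
move=> hf hg fg.
by apply: (le_Rintegral mD hf hg) => t /halflineP/fg.
Qed.

Lemma hl_int_ge0 f : (forall t, 0 < t -> 0 <= f t) -> 0 <= hl_int f.
Proof. by move=> h; apply: Rintegral_ge0 => t /halflineP/h. Qed.

Lemma hl_int_norm f : hl_integrable f -> `|hl_int f| <= hl_int (fun t => `|f t|).
Proof. by move=> hf; exact: (le_normr_Rintegral mD hf). Qed.

Lemma hl_int0 : hl_int (fun=> 0) = 0.
Proof. by rewrite /hl_int /Rintegral integral0. Qed.

Lemma hl_int_sum (I : Type) (r : seq I) (F : I -> R -> R) :
  (forall i, hl_integrable (F i)) ->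
  hl_int (fun t => \sum_(i <- r) F i t) = \sum_(i <- r) hl_int (F i).
Proof.
move=> h; elim: r => [|i r IH].
  by rewrite big_nil -[RHS]hl_int0; apply: eq_hl_int => t _; rewrite big_nil.
rewrite big_cons -IH -hl_intD//; last exact: hl_integrable_sum.
by apply: eq_hl_int => t _; rewrite big_cons.
Qed.

Lemma hl_int_EFin f : hl_integrable f -> ((hl_int f)%:E = \int[leb]_(t in D) (f t)%:E)%E.
Proof.
move=> hf; rewrite /hl_int /Rintegral fineK//.
exact: (integrable_fin_num mD hf).
Qed.

Lemma dominated_hl_int (F : nat -> R -> R) f g :
  (forall n, measurable_fun D (F n)) -> measurable_fun D f ->
  {ae leb, forall t, 0 < t -> F n t @[n --> \oo] --> f t} ->
  hl_integrable g -> (forall n t, 0 < t -> `|F n t| <= g t) ->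
  hl_int (F n) @[n --> \oo] --> hl_int f.
Proof.
move=> mF mf Ff hg Fg.
have hF n : hl_integrable (F n) by apply: hl_integrable_le hg => // t; exact: Fg.
have [] := @dominated_convergence _ _ R leb D mD
  (fun n => EFin \o F n) (EFin \o f) (EFin \o g).
- by move=> n; exact: mEFin.
- exact: mEFin.
- move: Ff; apply: filterS; first exact: (ae_filter_ringOfSetsType leb).
  move=> t Ff /halflineP t0.
  by apply: cvg_EFin; [exact: nearW|exact: Ff].
- exact: hg.
- by apply: aeW => t n /halflineP t0; rewrite /= lee_fin; exact: Fg.
move=> hf _; rewrite /= -hl_int_EFin// => /fine_cvgP[_].
exact.
Qed.

Lemma dominated_hl_int_cst0 (F : nat -> R -> R) f g :
  (forall n, measurable_fun D (F n)) -> measurable_fun D f ->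
  {ae leb, forall t, 0 < t -> F n t @[n --> \oo] --> f t} ->
  hl_integrable g -> (forall n t, 0 < t -> `|F n t| <= g t) ->
  (forall n, hl_int (F n) = 0) -> hl_int f = 0.
Proof.
move=> mF mf Ff hg Fg F0.
have := dominated_hl_int mF mf Ff hg Fg.
under eq_fun do rewrite F0.
by move=> /cvg_lim <-//; rewrite lim_cst.
Qed.

Lemma measurable_pow_exp b c : measurable_fun D (fun t => t `^ b * expR (- (c * t))).
Proof.
apply: (measurable_funS measurableT) => //; apply: measurable_funM.
  exact: measurable_powR.
by apply: measurableT_comp => //; apply: measurableT_comp.
Qed.

Lemma hl_integrable_exp c : 0 < c -> hl_integrable (fun t => expR (- (c * t))).
Proof.
move=> c0.
have := integrable_exponential_pdf (rate := c) c0.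
move=> h; have {}h : hl_integrable (exponential_pdf c).
  exact: (integrableS _ mD (@subsetT _ _) h).
have : hl_integrable (fun t => c^-1 * exponential_pdf c t) by exact: hl_integrableZ.
apply: eq_hl_integrable => t t0.
by rewrite exponential_pdfE ?ltW// mulrA mulVf ?gt_eqF// mul1r mulNr.
Qed.

Lemma hl_int_exp c : 0 < c -> hl_int (fun t => expR (- (c * t))) = c^-1.
Proof.
move=> c0; rewrite -[RHS]mulr1; apply: (canRL (mulKf (lt0r_neq0 c0))).
rewrite -hl_intZ; last exact: hl_integrable_exp.
have h := integral_exponential_pdf (rate := c) c0.
rewrite /hl_int Rintegral_itv_obnd_cbnd; last exact/hl_integrableZ/hl_integrable_exp.
rewrite /Rintegral integral_mkcond -[RHS]/(fine 1%E) -h.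
congr fine; apply: eq_integral => t _.
by rewrite /exponential_pdf !patchE; case: ifPn; rewrite // mulNr.
Qed.

(** Majorise t^b by 1 + t^(n+1) with b <= n+1, and t^(n+1) by the Taylor term of that degree in
    e^(ct). *)
Lemma powR_exp_bound b c : 0 <= b -> 0 < c ->
  exists2 K, 0 < K & forall t, 0 <= t -> t `^ b <= K * expR (c * t).
Proof.
move=> b0 c0; pose n := Num.truncn b.
have bn : b <= n.+1%:R by rewrite ltW// truncnS_gt.
have f0 : 0 < (n.+1`!%:R : R) by rewrite ltr0n fact_gt0.
exists (1 + n.+1`!%:R / c ^+ n.+1).
  by rewrite ltr_wpDr// divr_ge0 ?ltW// exprn_gt0.
move=> t t0.
have tb : t `^ b <= 1 + t ^+ n.+1.
  have [t1|t1] := leP t 1.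
    apply: (@le_trans _ _ 1); last by rewrite lerDl exprn_ge0.
    rewrite -[leRHS](powRr0 t); move: t0; rewrite le_eqVlt => /predU1P[<-|t0].
      by have [->|b1] := eqVneq b 0; rewrite ?powRr0// powR0// powRr0.
    by apply: ger_powR => //; rewrite t0.
  by apply: ler_wpDl => //; rewrite -powR_mulrn// (ler_powR (ltW t1)).
apply: (le_trans tb); rewrite mulrDl mul1r lerD//.
  by rewrite -[leLHS]expR0 ler_expR mulr_ge0// ltW.
have h : (c * t) ^+ n.+1 / n.+1`!%:R <= expR (c * t).
  apply: le_trans (expR_ge1Dxn n (mulr_ge0 (ltW c0) t0)).
  by rewrite lerDr.
rewrite mulrAC ler_pdivlMr ?exprn_gt0// -ler_pdivrMl//.
by rewrite mulrC -exprMn [t * c]mulrC.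
Qed.

Lemma hl_integrable_pow_exp b c : 0 <= b -> 0 < c ->
  hl_integrable (fun t => t `^ b * expR (- (c * t))).
Proof.
move=> b0 c0; have c20 : 0 < c / 2 by rewrite divr_gt0.
have [K K0 hK] := powR_exp_bound b0 c20.
have : hl_integrable (fun t => K * expR (- (c / 2 * t))) by exact/hl_integrableZ/hl_integrable_exp.
apply: hl_integrable_le; first exact: measurable_pow_exp.
move=> t t0; rewrite ger0_norm ?mulr_ge0 ?powR_ge0 ?expR_ge0//.
apply: le_trans (ler_wpM2r (expR_ge0 _) (hK t (ltW t0))) _.
by rewrite -[K * _ * _]mulrA (ler_pM2l K0) -expRD ler_expR; lra.
Qed.

Lemma hl_integrable_weight b : 0 <= b -> hl_integrable (weight b).
Proof.
move=> b0; apply: eq_hl_integrable (hl_integrable_pow_exp b0 ltr01) => t t0.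
by rewrite /weight mul1r.
Qed.

Lemma is_derive_powR t b : 0 < t ->
  is_derive t 1 (fun t => t `^ b) (b * t `^ (b - 1)).
Proof.
move=> t0; have t0' : t \in `]0, +oo[ by rewrite in_itv/= t0.
apply: DeriveDef; first exact: derivable_powR.
by rewrite -derive1E powR_derive1.
Qed.

Lemma is_derive_expRN t : is_derive t 1 (fun t => expR (- t)) (- expR (- t)).
Proof.
have h : is_derive t 1 (fun t : R => - t) (-1) by exact: is_deriveN.
have /is_derive_eq := is_derive1_comp (is_derive_expR (- t)) h; apply.
by rewrite mulrN1.
Qed.

Lemma is_derive_weight t b : 0 < t ->
  is_derive t 1 (weight b) ((b / t - 1) * weight b t).
Proof.
move=> t0.
have h1 := is_derive_powR b t0; have h2 := is_derive_expRN t.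
have /is_derive_eq := @is_deriveM _ _ _ _ t 1 _ _ h1 h2; apply.
rewrite /GRing.scale/= /weight.
have -> : t `^ (b - 1) = t `^ b / t.
  by rewrite powRB ?(gt_eqF t0) ?implybT// powRr1 ?ltW.
by field; rewrite gt_eqF.
Qed.

Lemma continuous_weight b t : 0 < t -> {for t, continuous (weight b)}.
Proof.
move=> t0; have [h _] := is_derive_weight b t0.
by apply: differentiable_continuous; exact/derivable1_diffP.
Qed.

Lemma weight_cvg0 b : 0 < b -> weight b t @[t --> 0^'+] --> 0.
Proof.
move=> b0; rewrite -[X in _ --> X](mul0r (expR (- 0))).
apply: cvgM; first exact: powR_cvg0.
apply: cvg_at_right_filter; apply: continuous_comp; last exact: continuous_expR.
exact: opp_continuous.
Qed.

Lemma cvg_expRN0 (k : R) : expR (- t) * k @[t --> (0:R)^'+] --> k.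
Proof.
rewrite -[X in _ --> X]mul1r -[X in X * k]expR0 -[X in expR X]oppr0.
apply: cvgM; last exact: cvg_cst.
apply: cvg_at_right_filter; apply: continuous_comp; last exact: continuous_expR.
exact: opp_continuous.
Qed.

Lemma weight_cvg b : 0 <= b -> weight b t @[t --> 0^'+] --> weight b 0.
Proof.
rewrite le_eqVlt => /predU1P[<-|b0].
  (* At b = 0 the limit is 1, in agreement with the convention 0^0 = 1 of [powR]. *)
  rewrite /weight powRr0 oppr0 expR0 mulr1.
  under eq_fun do rewrite powRr0 mul1r -[expR _]mulr1.
  exact: cvg_expRN0.
by rewrite {2}/weight powR0 ?gt_eqF// mul0r; exact: weight_cvg0.
Qed.

Lemma weight_cvgy b : 0 <= b -> weight b t @[t --> +oo] --> 0.
Proof.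
move=> b0; have c0 : 0 < 2^-1 :> R by rewrite invr_gt0.
have [K K0 hK] := powR_exp_bound b0 c0.
apply: (@squeeze_cvgr _ _ _ _ (cst 0) (fun t => K * expR (- (2^-1 * t)))).
- near=> t; have t0 : 0 < t by near: t; exact: nbhs_pinfty_gt.
  rewrite mulr_ge0 ?powR_ge0 ?expR_ge0//=.
  apply: le_trans (ler_wpM2r (expR_ge0 _) (hK t (ltW t0))) _.
  by rewrite -[K * _ * _]mulrA (ler_pM2l K0) -expRD ler_expR; lra.
- exact: cvg_cst.
- rewrite -[X in _ --> X](mulr0 K); apply: cvgM; first exact: cvg_cst.
  apply: (@cvg_comp _ _ _ (fun t => 2^-1 * t) (fun t => expR (- t)) _ +oo).
    exact: gt0_cvgMry.
  exact: cvgr_expR.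
Unshelve. all: end_near. Qed.

(* The antiderivative of [weight (b+1) - (b+1) weight b] does not have a
   derivative of constant sign; adding a multiple of [expR (-t/2)] repairs this,
   so that the improper fundamental theorem of calculus applies. *)
Lemma hl_int_weightS b : 0 <= b -> hl_int (weight (b + 1)) = (b + 1) * hl_int (weight b).
Proof.
move=> b0; have b10 : 0 < b + 1 by rewrite ltr_wpDl.
have c0 : 0 < 2^-1 :> R by rewrite invr_gt0.
have [K K0 hK] := powR_exp_bound b0 c0.
pose e (t : R) := expR (- (2^-1 * t)).
pose L := (b + 1) * K.
pose F t := - weight (b + 1) t - 2 * L * e t.
pose f t := weight (b + 1) t - (b + 1) * weight b t + L * e t.
have wle t : 0 <= t -> weight b t <= K * e t.
  move=> t0; apply: le_trans (ler_wpM2r (expR_ge0 _) (hK t t0)) _.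
  by rewrite -mulrA (ler_pM2l K0) -expRD ler_expR; lra.
have de t : is_derive t 1 e (- 2^-1 * e t).
  have h : is_derive t 1 (fun t => - (2^-1 * t)) (- 2^-1).
    have /is_derive_eq := is_deriveN (is_deriveZ 2^-1 (is_derive_id t (1 : R))).
    by apply; rewrite /GRing.scale/= mulr1.
  have /is_derive_eq := @is_derive1_comp _ expR (fun t => - (2^-1 * t)) t _ _ (is_derive_expR _) h.
  by apply; rewrite mulrC.
have ce : continuous e.
  move=> t; have [h _] := de t.
  by apply: differentiable_continuous; exact/derivable1_diffP.
have dF t : 0 < t -> is_derive t 1 F (f t).
  move=> t0; have dw := is_derive_weight (b + 1) t0.
  rewrite /F /f.
  have h1 := is_deriveN dw.
  have h2 := is_deriveZ (2 * L) (de t).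
  have /is_derive_eq := is_deriveB h1 h2; apply.
  rewrite /GRing.scale/= /weight powRD ?(gt_eqF t0) ?implybT// powRr1 ?ltW//.
  by field; rewrite gt_eqF.
have hf : hl_integrable f.
  apply: hl_integrableD; last exact/hl_integrableZ/hl_integrable_exp.
  by apply: hl_integrableB; [exact/hl_integrable_weight/ltW|exact/hl_integrableZ/hl_integrable_weight].
have : Rintegral leb `[0, +oo[ f = 0 - F 0.
  apply: Rintegral_ge0_continuous_FTC2y.
  - move=> t t0; rewrite /f /L -addrA addr_ge0//.
      by rewrite mulr_ge0 ?powR_ge0 ?expR_ge0.
    by rewrite addrC -mulrA -mulrBr mulr_ge0 ?subr_ge0 ?wle// ltW.
  - apply/continuous_within_itvcyP; split.
      move=> t; rewrite in_itv/= andbT => t0; rewrite /f.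
      apply: cvgD.
        apply: cvgB; first exact: continuous_weight.
        by apply: cvgM; [exact: cvg_cst|exact: continuous_weight].
      by apply: cvgM; [exact: cvg_cst|exact: ce].
    apply: cvgD.
      apply: cvgB; first exact/weight_cvg/ltW.
      by apply: cvgM; [exact: cvg_cst|exact: weight_cvg].
    apply: cvgM; [exact: cvg_cst|]; apply: cvg_at_right_filter; exact: ce.
  - rewrite -[X in _ --> X]subr0; apply: cvgB.
      by rewrite -oppr0; apply: cvgN; exact/weight_cvgy/ltW.
    rewrite -[X in _ --> X](mulr0 (2 * L)); apply: cvgM; first exact: cvg_cst.
    apply: (@cvg_comp _ _ _ (fun t => 2^-1 * t) (fun t => expR (- t)) _ +oo).
      exact: gt0_cvgMry.
    exact: cvgr_expR.
  - by move=> t /dF[].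
  - rewrite /F; apply: cvgB; first by apply: cvgN; exact/weight_cvg/ltW.
    apply: cvgM; [exact: cvg_cst|]; apply: cvg_at_right_filter; exact: ce.
  - move=> t; rewrite in_itv/= andbT => t0.
    by rewrite derive1E; have [_ ->] := dF _ t0.
rewrite -Rintegral_itv_obnd_cbnd//.
have -> : F 0 = - (2 * L).
  by rewrite /F /weight powR0 ?gt_eqF// mul0r oppr0 /e mulr0 oppr0 expR0 mulr1 sub0r.
rewrite -[Rintegral _ _ _]/(hl_int f) /f hl_intD; last 2 first.
- by apply: hl_integrableB; [exact/hl_integrable_weight/ltW|exact/hl_integrableZ/hl_integrable_weight].
- exact/hl_integrableZ/hl_integrable_exp.
rewrite hl_intB; last 2 first.
- exact/hl_integrable_weight/ltW.
- exact/hl_integrableZ/hl_integrable_weight.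
rewrite hl_intZ; last exact: hl_integrable_weight.
rewrite hl_intZ; last exact: hl_integrable_exp.
have -> : hl_int e = 2.
  by rewrite hl_int_exp// invrK.
lra.
Qed.

End Halfline.

Global Opaque hl_int.

(** * Values and positivity of the gamma integrals *)

Section GammaFacts.
Context {R : realType}.
Implicit Types (a b c t x : R) (k m n : nat).

(** The tangent at 1 to a convex power. Splitting off one factor x leaves the exponent a - 1 >= 0,
    for which e^u >= 1 + u and ln x >= 1 - 1/x suffice. This inequality replaces Jensen's in the
    gamma estimates below. *)
Lemma bernoulli_powR a x : 1 <= a -> 0 <= x -> 1 + a * (x - 1) <= x `^ a.
Proof.
move=> a1; rewrite le_eqVlt => /predU1P[<-|x0].
  by rewrite powR0 ?gt_eqF ?(lt_le_trans ltr01)//; lra.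
have lnx : 1 - x^-1 <= ln x.
  have : ln (1 + (x^-1 - 1)) <= x^-1 - 1.
    have : 0 < x^-1 by rewrite invr_gt0.
    by move=> h; apply: le_ln1Dx; lra.
  by rewrite subrKC lnV ?posrE//; lra.
have -> : x `^ a = x * expR ((a - 1) * ln x).
  rewrite -[in LHS](subrKC 1 a) powRD ?(gt_eqF x0) ?implybT// powRr1 ?ltW//.
  by congr (_ * _); rewrite /powR gt_eqF.
apply: (@le_trans _ _ (x * (1 + (a - 1) * (1 - x^-1)))).
  by rewrite le_eqVlt; apply/orP; left; apply/eqP; field; rewrite gt_eqF.
rewrite ler_pM2l//; apply: le_trans (expR_ge1Dx _).
by rewrite lerD2l; apply: ler_wpM2l => //; lra.
Qed.

Lemma weightMn b n t : 0 < t -> weight b t * t ^+ n = weight (b + n%:R) t.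
Proof.
move=> t0; rewrite /weight powRD ?(gt_eqF t0) ?implybT// powR_mulrn ?ltW//.
by rewrite mulrAC.
Qed.

Lemma hl_int_weight0 : hl_int (weight (0 : R)) = 1.
Proof.
rewrite -[RHS]invr1 -(hl_int_exp ltr01); apply: eq_hl_int => t t0.
by rewrite /weight powRr0 !mul1r.
Qed.

Lemma hl_int_weight_nat n : hl_int (weight (n%:R : R)) = n`!%:R.
Proof.
elim: n => [|n IH]; first exact: hl_int_weight0.
by rewrite -natr1 hl_int_weightS// IH factS natrM -natr1.
Qed.

(** The exponential law has mean 1, so the tangent to t^b at t = 1 integrates to its value 1
    there. *)
Lemma hl_int_weight_ge1 b : 1 <= b -> 1 <= hl_int (weight b).
Proof.
move=> b1; have b0 : 0 <= b by rewrite (le_trans _ b1).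
have i0 := hl_integrable_weight (lexx (0 : R)); have i1 := hl_integrable_weight (@ler01 R).
have -> : 1 = hl_int (fun t => (1 - b) * weight 0 t + b * weight 1 t).
  rewrite hl_intD ?hl_intZ//; try exact: hl_integrableZ.
  by rewrite hl_int_weight0 (hl_int_weight_nat 1) (_ : 1`! = 1%N)// !mulr1 subrK.
apply: hl_int_le; [by apply: hl_integrableD; exact: hl_integrableZ|exact: hl_integrable_weight|move=> t t0].
rewrite /weight powRr0 (powRr1 (ltW t0)).
rewrite [leLHS](_ : _ = (1 + b * (t - 1)) * expR (- t)); last by ring.
apply: ler_wpM2r; first exact: expR_ge0.
exact: bernoulli_powR (ltW t0).
Qed.

(** The functional equation moves the question to b + 1 >= 1, where the tangent bound applies. *)
Lemma hl_int_weight_gt0 b : 0 <= b -> 0 < hl_int (weight b).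
Proof.
move=> b0; have b10 : 0 < b + 1 by lra.
rewrite -(pmulr_rgt0 _ b10) -hl_int_weightS//.
by apply: lt_le_trans ltr01 (hl_int_weight_ge1 _); lra.
Qed.

End GammaFacts.

(** * Finite differences of rising factorials *)

Section RisingFactorial.
Context {R : comNzRingType}.
Implicit Types (x : R) (f : R -> R) (k m n : nat).

Definition rising n x : R := \prod_(i < n) (x + i%:R).

(** This is (-1)^k times the k-th forward difference. Orthogonality of the Laguerre polynomials
    comes down to its annihilating polynomials of degree below k. *)
Definition alt_diff k f x : R :=
  \sum_(m < k.+1) (-1) ^+ m * 'C(k, m)%:R * f (x + m%:R).

Lemma risingSr n x : rising n.+1 x = rising n x * (x + n%:R).
Proof. by rewrite /rising big_ord_recr. Qed.

Lemma risingSl n x : rising n.+1 x = x * rising n (x + 1).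
Proof.
rewrite /rising big_ord_recl addr0; congr (_ * _); apply: eq_bigr => i _.
by rewrite -addrA -natr1 [1 + _]addrC.
Qed.

Lemma alt_diffS k f x : alt_diff k.+1 f x = alt_diff k f x - alt_diff k f (x + 1).
Proof.
have -> : alt_diff k f x = \sum_(m < k.+2) (-1) ^+ m * 'C(k, m)%:R * f (x + m%:R).
  by rewrite big_ord_recr /= bin_small// mulr0 mul0r addr0.
rewrite /alt_diff big_ord_recl [in RHS]big_ord_recl /= !bin0 -addrA; congr (_ + _).
rewrite -sumrB; apply: eq_bigr => i _; rewrite /bump add1n binS natrD exprS.
rewrite -addrA [1 + i%:R]addrC natr1; ring.
Qed.

Lemma alt_diff_rising k n x :
  alt_diff k.+1 (rising n.+1) x = - n.+1%:R * alt_diff k (rising n) (x + 1).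
Proof.
rewrite alt_diffS /alt_diff -sumrB mulr_sumr; apply: eq_bigr => i _.
rewrite risingSl [x + 1 + _]addrAC risingSr -natr1; ring.
Qed.

Lemma alt_diff_rising0 k n x : (n < k)%N -> alt_diff k (rising n) x = 0.
Proof.
elim: n k x => [|n IH] [|k] x//; last first.
  by rewrite ltnS alt_diff_rising => /IH ->; rewrite mulr0.
move=> _; rewrite alt_diffS; apply/eqP; rewrite subr_eq0; apply/eqP.
by apply: eq_bigr => i _; rewrite /rising !big_ord0.
Qed.

Lemma alt_diff_rising_diag k x : alt_diff k (rising k) x = (-1) ^+ k * k`!%:R.
Proof.
elim: k x => [|k IH] x.
  by rewrite /alt_diff big_ord_recl big_ord0 /rising big_ord0 bin0 addr0 !mulr1.
by rewrite alt_diff_rising IH factS natrM exprS; ring.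
Qed.

End RisingFactorial.

(** * Gamma quotients and orthonormality of the Laguerre system *)

Section LaguerreBasics.
Context {R : realType}.
Variable al : R.
Hypothesis al0 : 0 <= al.
Implicit Types (t x : R) (k m n j : nat) (p q : {poly R}).

(* Gamma (k + alpha + 1) *)
Definition gam k : R := hl_int (weight (k%:R + al)).

Lemma GammaE x : Gamma (x + 1) = hl_int (weight x).
Proof. by rewrite /Gamma addrK. Qed.

Lemma kal_ge0 k : 0 <= k%:R + al. Proof. by rewrite addr_ge0. Qed.

Lemma gam_gt0 k : 0 < gam k.
Proof. exact/hl_int_weight_gt0/kal_ge0. Qed.

Lemma gam_neq0 k : gam k != 0.
Proof. by rewrite gt_eqF ?gam_gt0. Qed.

Lemma gamS k : gam k.+1 = (k%:R + al + 1) * gam k.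
Proof. by rewrite /gam -natr1 addrAC hl_int_weightS ?kal_ge0. Qed.

Lemma gam_rising k n : gam (k + n) = gam k * rising n (k%:R + al + 1).
Proof.
elim: n => [|n IH]; first by rewrite addn0 /rising big_ord0 mulr1.
rewrite addnS gamS IH risingSr natrD; ring.
Qed.

Lemma gam0_le m : gam 0 <= gam m.
Proof.
elim: m => [|m IH]; first exact: lexx.
apply: (le_trans IH).
rewrite gamS; apply: ler_peMl; first exact/ltW/gam_gt0.
by rewrite lerDr kal_ge0.
Qed.

(** After the case split K = [k.+1], and t^(K-1) e^(-t) is up to a constant the density of a gamma
    law of mean K. Hence the tangent at K to the convex function t^(1+al), given by [bernoulli_powR]
    at t/K, integrates to its value at K. *)
Lemma gam_lower k : (0 < k)%N -> k%:R `^ al * k`!%:R <= gam k.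
Proof.
case: k => // k _; set K : R := k.+1%:R.
have K0 : 0 < K by rewrite ltr0n.
have i0 : hl_integrable (weight (k%:R : R)) by exact: hl_integrable_weight.
have i1 : hl_integrable (weight K) by apply: hl_integrable_weight; exact: ltW.
have -> : K `^ al * k.+1`!%:R =
   hl_int (fun t => (K `^ (1 + al) * - al) * weight k%:R t +
                (K `^ (1 + al) * ((1 + al) / K)) * weight K t).
  rewrite hl_intD ?hl_intZ//; try exact: hl_integrableZ.
  rewrite !hl_int_weight_nat factS natrM -/K powRD ?(gt_eqF K0) ?implybT//.
  by rewrite powRr1 ?ltW//; field; rewrite gt_eqF.
apply: hl_int_le; [by apply: hl_integrableD; exact: hl_integrableZ|
  exact/hl_integrable_weight/kal_ge0|move=> t t0].
have -> : weight K t = t * weight k%:R t.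
  by rewrite /K -natr1 -(weightMn _ 1)// expr1 mulrC.
have -> : weight (K + al) t = t `^ (1 + al) * weight k%:R t.
  by rewrite mulrA /K -natr1 -addrA addrC [in LHS]/weight powRD//
    (gt_eqF t0) implybT.
rewrite [_ * (t * _)]mulrA -mulrDl; apply: ler_wpM2r.
  by rewrite mulr_ge0 ?powR_ge0 ?expR_ge0.
have tK : 0 <= t / K by rewrite divr_ge0 ?ltW.
have al1 : 1 <= 1 + al by rewrite lerDl.
have := bernoulli_powR al1 tK.
rewrite (powRM _ (ltW t0)) ?invr_ge0 ?(ltW K0)// => h.
have Kp : 0 < K `^ (1 + al) by rewrite powR_gt0.
have := ler_wpM2l (ltW Kp) h.
have -> : K `^ (1 + al) * (t `^ (1 + al) * K^-1 `^ (1 + al)) = t `^ (1 + al).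
  rewrite mulrCA -powRM ?invr_ge0 ?(ltW K0)// mulfV ?gt_eqF//.
  by rewrite powR1 mulr1.
apply: le_trans; rewrite le_eqVlt; apply/orP; left; apply/eqP.
by field; rewrite gt_eqF.
Qed.

Lemma fact_le_expn k n : ((k + n)`! <= k`! * (k + n) ^ n)%N.
Proof.
elim: n => [|n IH]; first by rewrite addn0 expn0 muln1.
rewrite addnS factS expnS mulnCA leq_mul2l/=; apply: (leq_trans IH).
rewrite leq_mul2l; apply/orP; right; case: n {IH} => // n.
by rewrite leq_exp2r.
Qed.

(** With an integer n >= al, (t/K)^al <= 1 + (t/K)^n reduces the claim to the integer factorials k!
    and (k+n)!. *)
Lemma gam_upper : exists2 C, 0 < C &
  forall k, (0 < k)%N -> gam k <= C * (k%:R `^ al * k`!%:R).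
Proof.
pose n := (Num.truncn al).+1.
have aln : al <= n%:R by rewrite ltW// truncnS_gt.
exists (1 + ((1 + n) ^ n)%:R); first by rewrite ltr_pwDl.
move=> k k0; set K : R := k%:R; have K0 : 0 < K by rewrite ltr0n.
have i0 : hl_integrable (weight K) by apply: hl_integrable_weight; exact: ltW.
have i1 : hl_integrable (weight ((k + n)%:R : R)) by exact: hl_integrable_weight.
apply: (@le_trans _ _
   (hl_int (fun t => K `^ al * weight K t + (K `^ al / K ^+ n) * weight (k + n)%:R t))).
  apply: hl_int_le; [exact/hl_integrable_weight/kal_ge0|by apply: hl_integrableD; exact: hl_integrableZ|].
  move=> t t0; rewrite natrD -/K -(weightMn _ n)//.
  have -> : weight (K + al) t = t `^ al * weight K t.
    by rewrite mulrA addrC [in LHS]/weight powRD// (gt_eqF t0) implybT.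
  have : 0 <= weight K t by rewrite mulr_ge0 ?powR_ge0 ?expR_ge0.
  move: (weight K t) => W W0.
  rewrite [W * _]mulrC mulrA -mulrDl; apply: ler_wpM2r => //.
  rewrite -mulrA -{1}[K `^ al]mulr1 -mulrDr.
  have tK : 0 <= t / K by rewrite divr_ge0 ?ltW.
  have -> : t `^ al = K `^ al * (t / K) `^ al.
    rewrite -(powRM _ (ltW K0) tK); congr (_ `^ _); by field; rewrite gt_eqF.
  apply: ler_wpM2l; first exact: powR_ge0.
  rewrite [K ^- n * _]mulrC -expr_div_n.
  have [h|h] := leP (t / K) 1.
    apply: (@le_trans _ _ 1); last by rewrite lerDl exprn_ge0.
    rewrite -[leRHS](powRr0 (t / K)); apply: ger_powR => //.
    by rewrite divr_gt0.
  by apply: ler_wpDl => //; rewrite -powR_mulrn// (ler_powR (ltW h)).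
rewrite hl_intD ?hl_intZ//; try exact: hl_integrableZ.
rewrite !hl_int_weight_nat mulrDl mul1r lerD2l.
rewrite mulrAC ler_pdivrMr ?exprn_gt0//.
rewrite -mulrA [leRHS]mulrCA -[leRHS]mulrA; apply: ler_wpM2l; first exact: powR_ge0.
rewrite -natrX -!natrM ler_nat; apply: leq_trans (fact_le_expn _ _) _.
have e : ((k + n) ^ n <= ((1 + n) * k) ^ n)%N.
  by rewrite leq_exp2r//; nia.
apply: leq_trans (leq_mul (leqnn _) e) _; rewrite expnMn; lia.
Qed.

(* The k-th Laguerre polynomial rescaled to the value 1 / Gamma (alpha + 1) at 0. *)
Definition lagp k : {poly R} :=
  \poly_(m < k.+1) ((-1) ^+ m * 'C(k, m)%:R / gam m).

Lemma coef_lagp k m : (lagp k)`_m = (-1) ^+ m * 'C(k, m)%:R / gam m.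
Proof.
rewrite coef_poly; case: ltnP => // km; by rewrite bin_small// mulr0 mul0r.
Qed.

Lemma horner_lagp k t :
  (lagp k).[t] = \sum_(m < k.+1) 'C(k, m)%:R / gam m * (- t) ^+ m.
Proof.
rewrite horner_poly; apply: eq_bigr => m _; rewrite -[- t]mulN1r exprMn; ring.
Qed.

Lemma LaguerreE k t : Laguerre al k t = gam k / k`!%:R * (lagp k).[t].
Proof.
rewrite horner_lagp mulr_sumr; apply: eq_bigr => m _.
have mk : (m <= k)%N by rewrite -ltnS.
rewrite !GammaE -!/(gam _).
have := bin_fact mk; move=> /(congr1 (fun n => n%:R : R)); rewrite !natrM => <-.
have h1 := gam_neq0 m.
have f n : n`!%:R != 0 :> R by rewrite pnatr_eq0 -lt0n fact_gt0.
have h2 := f m. have h3 := f (k - m)%N.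
have h4 : 'C(k, m)%:R != 0 :> R by rewrite pnatr_eq0 -lt0n bin_gt0.
move: (gam m) (gam k) h1 => g1 g2 h1.
by field; rewrite h1 h2 h3 h4.
Qed.

(** The reciprocal of the norm of [lagp k] in L_{2,w}, as [pdot_lagp] confirms. *)
Definition lagnorm k : R := Num.sqrt (gam k / k`!%:R).

Lemma gamf_gt0 k : 0 < gam k / k`!%:R.
Proof. by rewrite divr_gt0 ?gam_gt0// ltr0n fact_gt0. Qed.

Lemma lagnorm_gt0 k : 0 < lagnorm k.
Proof. by rewrite sqrtr_gt0 gamf_gt0. Qed.

Lemma lagnorm_sqr k : lagnorm k ^+ 2 = gam k / k`!%:R.
Proof. by rewrite sqr_sqrtr// ltW// gamf_gt0. Qed.

Lemma ellE k t : ell al k t = lagnorm k * (lagp k).[t].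
Proof.
rewrite /ell LaguerreE mulrA; congr (_ * _).
rewrite GammaE -/(gam k) -lagnorm_sqr.
have -> : k`!%:R / gam k = (lagnorm k ^+ 2)^-1 by rewrite lagnorm_sqr invf_div.
by rewrite -exprVn sqrtr_sqr ger0_norm ?invr_ge0 ?ltW ?lagnorm_gt0// expr2 mulKf
  // gt_eqF// lagnorm_gt0.
Qed.

Lemma hl_integrable_pow_exp_poly b c p : 0 <= b -> 0 < c ->
  hl_integrable (fun t => t `^ b * expR (- (c * t)) * p.[t]).
Proof.
move=> b0 c0; have : hl_integrable (fun t => \sum_(i < size p)
    p`_i * (t `^ (b + i%:R) * expR (- (c * t)))).
  by apply: hl_integrable_sum => i; apply/hl_integrableZ/hl_integrable_pow_exp => //; rewrite addr_ge0.
apply: eq_hl_integrable => t t0; rewrite horner_coef mulr_sumr; apply: eq_bigr => i _.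
rewrite powRD ?(gt_eqF t0) ?implybT// powR_mulrn ?ltW//; ring.
Qed.

Lemma hl_integrable_weight_poly p : hl_integrable (fun t => weight al t * p.[t]).
Proof.
apply: eq_hl_integrable (hl_integrable_pow_exp_poly p al0 ltr01) => t t0.
by rewrite mul1r.
Qed.

Definition pdot p q : R := hl_int (fun t => weight al t * p.[t] * q.[t]).

Lemma pdotE p q : pdot p q = hl_int (fun t => weight al t * (p * q).[t]).
Proof. by apply: eq_hl_int => t _; rewrite hornerM mulrA. Qed.

Lemma pdotC p q : pdot p q = pdot q p.
Proof. by rewrite !pdotE mulrC. Qed.

Lemma pdot_sum (I : Type) (r : seq I) (P : I -> {poly R}) q :
  pdot (\sum_(i <- r) P i) q = \sum_(i <- r) pdot (P i) q.
Proof.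
rewrite pdotE; under [RHS]eq_bigr do rewrite pdotE.
rewrite -hl_int_sum; last by move=> i; exact: hl_integrable_weight_poly.
by apply: eq_hl_int => t _; rewrite mulr_suml horner_sum mulr_sumr.
Qed.

Lemma pdotZ c p q : pdot (c *: p) q = c * pdot p q.
Proof.
rewrite !pdotE -hl_intZ; last exact: hl_integrable_weight_poly.
by apply: eq_hl_int => t _; rewrite -(scalerAl c p q) hornerZ mulrCA.
Qed.

(** The coefficients of [lagp] carry 1 / [gam m], and [gam (m + n) / gam m] is a polynomial of
    degree n in m. A moment therefore becomes a k-th difference of that polynomial. *)
Lemma pdot_Xn_lagp n k :
  pdot 'X^n (lagp k) = alt_diff k (rising n) (al + 1).
Proof.
transitivity (hl_int (fun t => \sum_(m < k.+1)
    ((-1) ^+ m * 'C(k, m)%:R / gam m) * weight ((m + n)%:R + al) t)).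
  apply: eq_hl_int => t t0; rewrite horner_poly hornerXn mulr_sumr.
  apply: eq_bigr => m _; rewrite addrC -(weightMn _ _)// exprD; ring.
rewrite hl_int_sum; last by move=> i; exact/hl_integrableZ/hl_integrable_weight/kal_ge0.
apply: eq_bigr => m _; rewrite hl_intZ; last exact/hl_integrable_weight/kal_ge0.
rewrite -/(gam _) gam_rising -[_ + al + 1]addrA addrC.
by rewrite mulrA divfK ?gam_neq0// addrC.
Qed.

Lemma pdot_lagp j k : pdot (lagp j) (lagp k) = (j == k)%:R * (k`!%:R / gam k).
Proof.
(* With j <= k, every monomial of [lagp j] has degree at most k, and only the top one can survive,
   when j = k. *)
wlog : j k / (j <= k)%N => [wl|].
  have [|/ltnW kj] := leqP j k; first exact: wl.
  rewrite pdotC (wl _ _ kj) eq_sym; have [->|_] := eqVneq j k; first by [].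
  by rewrite !mul0r.
move=> jk; rewrite {1}/lagp poly_def pdot_sum.
under eq_bigr do rewrite pdotZ pdot_Xn_lagp.
rewrite big_ord_recr/= big1 ?add0r; last first.
  move=> i _; rewrite alt_diff_rising0 ?mulr0//.
  exact: leq_trans (ltn_ord i) jk.
have [<-|njk] := eqVneq j k.
  rewrite alt_diff_rising_diag binn.
  have e : (-1) ^+ j * (-1) ^+ j = 1 :> R by rewrite -expr2 sqrr_sign.
  transitivity ((-1) ^+ j * (-1) ^+ j * (j`!%:R / gam j)); last by rewrite e.
  by rewrite mulr1 mulrACA [_^-1 * _]mulrC.
by rewrite mul0r alt_diff_rising0 ?mulr0// ltn_neqAle njk.
Qed.

Lemma dotw_ell j k : dotw al (ell al j) (ell al k) = (j == k)%:R.
Proof.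
transitivity (lagnorm j * lagnorm k * pdot (lagp j) (lagp k)).
  rewrite pdotE -hl_intZ; last exact: hl_integrable_weight_poly.
  by apply: eq_hl_int => t _; rewrite !ellE hornerM; ring.
rewrite pdot_lagp; have [->|_] := eqVneq j k; last by rewrite mul0r mulr0.
rewrite -expr2 lagnorm_sqr mul1r -[RHS]/(1 : R).
have := gam_neq0 k; have : k`!%:R != 0 :> R by rewrite pnatr_eq0 -lt0n fact_gt0.
by move=> h1 h2; field; rewrite h1 h2.
Qed.

End LaguerreBasics.

(** * Laguerre functions near the origin *)

Section NearZero.
Context {R : realType}.
Variable al : R.
Hypothesis al0 : 0 <= al.
Implicit Types (t x c : R) (k m n : nat).

Definition lagf k t : R := ell al k t * sqrtw al t.

Lemma weight_ge0 t : 0 <= weight al t.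
Proof. by rewrite mulr_ge0 ?powR_ge0 ?expR_ge0. Qed.

Lemma sqrtw_sqr t : sqrtw al t ^+ 2 = weight al t.
Proof. by rewrite sqr_sqrtr// weight_ge0. Qed.

Lemma sqrtw_gt0 t : 0 < t -> 0 < sqrtw al t.
Proof. by move=> t0; rewrite sqrtr_gt0 mulr_gt0 ?powR_gt0 ?expR_gt0. Qed.

Lemma sqrtwE t : 0 < t -> sqrtw al t = t `^ (al / 2) * expR (- (2^-1 * t)).
Proof.
move=> t0; rewrite /sqrtw /weight.
have -> : t `^ al * expR (- t) = (t `^ (al / 2) * expR (- (2^-1 * t))) ^+ 2.
  rewrite exprMn -powR_mulrn ?powR_ge0// -powRrM -expRM_natr.
  by congr (_ `^ _ * expR _); field.
by rewrite sqrtr_sqr ger0_norm// mulr_ge0 ?powR_ge0 ?expR_ge0.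
Qed.

Lemma lagf_sqr k t : lagf k t ^+ 2 = lagnorm al k ^+ 2 * (lagp al k).[t] ^+ 2 * weight al t.
Proof. by rewrite /lagf ellE// !exprMn sqrtw_sqr. Qed.

(** As [gam m >= gam 0], the nonconstant terms are dominated by those of the binomial expansion of
    (1 + t)^k, divided by [gam 0]. *)
Lemma lagp_near0 k t : 0 <= t ->
  `|(lagp al k).[t] - (gam al 0)^-1| <= ((1 + t) ^+ k - 1) / gam al 0.
Proof.
move=> t0; have g0 := gam_gt0 al0 0.
rewrite horner_lagp big_ord_recl /= bin0 expr0 mulr1 mul1r [_^-1 + _]addrC addrK.
apply: le_trans (ler_norm_sum _ _ _) _.
rewrite exprDn big_ord_recl /= bin0 expr0 mulr1 expr1n mulr1n [1 + _]addrC addrK.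
rewrite mulr_suml; apply: ler_sum => i _; rewrite /bump add1n.
rewrite expr1n mul1r normrM normrX normrN (ger0_norm t0).
rewrite ger0_norm ?divr_ge0 ?(ltW (gam_gt0 al0 _))//.
rewrite -(mulr_natl (t ^+ i.+1)) [leRHS]mulrAC.
apply: ler_wpM2r; first exact: exprn_ge0.
apply: ler_wpM2l; first exact: ler0n.
by rewrite lef_pV2 ?posrE; [exact: gam0_le|exact: gam_gt0|exact: gam_gt0].
Qed.

Lemma expr1D_le k t : 0 <= t -> (1 + t) ^+ k <= expR (k%:R * t).
Proof.
move=> t0; rewrite expRM_natl; apply: lerXn2r; rewrite ?nnegrE ?expR_ge0//.
  by rewrite addr_ge0.
exact: expR_ge1Dx.
Qed.

Lemma lagnorm_lower k : (0 < k)%N -> k%:R `^ (al / 2) <= lagnorm al k.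
Proof.
move=> k0; have f0 : 0 < k`!%:R :> R by rewrite ltr0n fact_gt0.
rewrite -(@ler_pXn2r _ 2)// ?nnegrE ?powR_ge0// ?(ltW (lagnorm_gt0 al0 _))//.
rewrite lagnorm_sqr// ler_pdivlMr//; apply: le_trans (gam_lower al0 k0).
by rewrite -powR_mulrn ?powR_ge0// -powRrM divfK.
Qed.

(** Two losses occur. Since e^(1/6) <= 6/5, the polynomial keeps at least 4/5 of its value at 0;
    since t <= 1/12, the factor e^(-t/2) is at least 23/24. The product 23/30 exceeds 0.7039. *)
Lemma lagf_lower k t : (0 < k)%N -> 0 < t -> k%:R * t <= 6^-1 -> t <= 12^-1 ->
  (k%:R * t) `^ (al / 2) * (7039 / 10000 / gam al 0) <= lagf k t.
Proof.
move=> k0 t0 kt t12; have g0 := gam_gt0 al0 0.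
have e6 : expR (6^-1) <= 6 / 5 :> R.
  have := expR_ge1Dx (- 6^-1 : R); rewrite expRN => h.
  have e0 : 0 < expR (6^-1 : R) by exact: expR_gt0.
  have : (1 + - 6^-1) * expR (6^-1) <= 1 :> R.
    by rewrite -ler_pdivlMr// div1r.
  lra.
have pw : (1 + t) ^+ k <= 6 / 5.
  by apply: le_trans (expr1D_le k (ltW t0)) (le_trans _ e6); rewrite ler_expR.
have P : (4 / 5) / gam al 0 <= (lagp al k).[t].
  have := lagp_near0 k (ltW t0); rewrite ler_norml => /andP[h _].
  have : ((1 + t) ^+ k - 1) / gam al 0 <= (6 / 5 - 1) / gam al 0.
    by rewrite ler_pM2r ?invr_gt0//; lra.
  have : 0 < (gam al 0)^-1 by rewrite invr_gt0.
  move: h; rewrite -[in X in _ <= X -> _](mul1r (gam al 0)^-1); lra.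
have E : 23 / 24 <= expR (- (2^-1 * t)).
  by apply: le_trans (expR_ge1Dx _); lra.
have gl : k%:R `^ (al / 2) * t `^ (al / 2) <= lagnorm al k * t `^ (al / 2).
  by apply: ler_wpM2r; [exact: powR_ge0|exact: lagnorm_lower].
have kp : 0 <= k%:R `^ (al / 2) * t `^ (al / 2) by rewrite mulr_ge0 ?powR_ge0.
rewrite /lagf ellE// sqrtwE// (powRM _ _ (ltW t0)); last by rewrite ler0n.
move: gl kp E P; move: (k%:R `^ (al / 2) * t `^ (al / 2)) (lagnorm al k) (t `^ (al / 2)).
move: (expR (- (2^-1 * t))) (lagp al k).[t].
move=> F P A B C gl kp hF hP.
have -> : B * P * (C * F) = (B * C) * (P * F) by ring.
have i0 : 0 < (gam al 0)^-1 by rewrite invr_gt0.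
move: i0 hP; move: (gam al 0)^-1 => G i0 hP.
apply: ler_pM gl _; [exact: kp|lra|].
apply: (@le_trans _ _ ((4 / 5 * G) * (23 / 24))); first by lra.
by apply: ler_pM hP hF; lra.
Qed.

(** The growth k^al of the squared normalisation is compensated by the factor t^al of the weight, as
    (k t)^al <= c^al. *)
Lemma lagf_upper_near0 c : 0 < c -> exists2 C, 0 < C &
  forall k t, 0 < t -> (maxn 1 k)%:R * t <= c -> lagf k t ^+ 2 <= C.
Proof.
move=> c0; have g0 := gam_gt0 al0 0; have [C1 C10 hC1] := gam_upper al0.
pose C2 := C1 * c `^ al * (expR c / gam al 0) ^+ 2.
have C20 : 0 < C2.
  apply: mulr_gt0; first by apply: mulr_gt0; [exact: C10|exact: powR_gt0].
  by apply: exprn_gt0; apply: divr_gt0; [exact: expR_gt0|exact: g0].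
(* The second summand is for k = 0, which [gam_upper] does not cover. *)
exists (C2 + c `^ al / gam al 0).
  by rewrite addr_gt0 ?divr_gt0 ?powR_gt0.
have wle k t : (0 < k)%N -> 0 < t -> k%:R * t <= c -> k%:R `^ al * weight al t <= c `^ al.
  move=> k0 t0 kt; rewrite /weight mulrA -powRM ?(ltW t0)//.
  apply: (@le_trans _ _ ((k%:R * t) `^ al)).
    by apply: ler_piMr; rewrite ?powR_ge0// expR_le1 oppr_le0 ltW.
  by apply: ge0_ler_powR; rewrite ?nnegrE ?mulr_ge0 ?(ltW t0) ?(ltW c0).
move=> k t t0; have [->|] := posnP k.
  move=> kt; rewrite lagf_sqr lagnorm_sqr// fact0 divr1.
  have -> : (lagp al 0).[t] = (gam al 0)^-1.
    by rewrite horner_lagp big_ord_recl big_ord0 bin0 expr0 mulr1 mul1r addr0.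
  apply: ler_wpDl; first exact: ltW.
  have -> : gam al 0 * (gam al 0)^-1 ^+ 2 * weight al t = weight al t / gam al 0.
    by field; exact: lt0r_neq0.
  rewrite ler_pM2r ?invr_gt0//.
  by have := wle 1%N t isT t0 kt; rewrite powR1 mul1r.
move=> k0; rewrite (maxn_idPr k0) => kt.
apply: ler_wpDr; first by rewrite divr_ge0 ?powR_ge0 ?ltW.
rewrite lagf_sqr lagnorm_sqr//.
have f0 : 0 < k`!%:R :> R by rewrite ltr0n fact_gt0.
have G : gam al k / k`!%:R <= C1 * k%:R `^ al.
  by rewrite ler_pdivrMr// -mulrA hC1.
have P : (lagp al k).[t] ^+ 2 <= (expR c / gam al 0) ^+ 2.
  have h := lagp_near0 k (ltW t0).
  have e : (1 + t) ^+ k <= expR c.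
    by apply: le_trans (expr1D_le k (ltW t0)) _; rewrite ler_expR.
  have h2 : `|(lagp al k).[t]| <= expR c / gam al 0.
    rewrite -[(lagp al k).[t]](subrK (gam al 0)^-1).
    apply: le_trans (ler_normD _ _) _.
    rewrite [X in _ + X]ger0_norm ?invr_ge0 ?(ltW g0)//.
    apply: (le_trans (lerD h (lexx _))).
    rewrite mulrBl mul1r subrK ler_pM2r ?invr_gt0//.
  by rewrite -[_ ^+ 2]ger0_norm ?sqr_ge0// normrX lerXn2r ?nnegrE//
    divr_ge0 ?expR_ge0 ?(ltW g0).
have := ler_pM (ltW (gamf_gt0 al0 k)) (sqr_ge0 _) G P.
move=> /(ler_wpM2r (weight_ge0 t)) /le_trans; apply.
have -> : C1 * k%:R `^ al * (expR c / gam al 0) ^+ 2 * weight al t =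
  C1 * (expR c / gam al 0) ^+ 2 * (k%:R `^ al * weight al t) by ring.
rewrite /C2 [leRHS]mulrAC; apply: ler_wpM2l; last exact: wle.
by rewrite mulr_ge0 ?sqr_ge0 ?(ltW C10).
Qed.

End NearZero.

(** * Uniform bound for the Laguerre functions *)

Section UniformBound.
Context {R : realType}.
Variable al : R.
Hypothesis al0 : 0 <= al.
Implicit Types (t x c : R).
Local Notation leb := (@lebesgue_measure R).

Lemma ndecr_is_derive (f df : R -> R) (a b : R) : a <= b ->
  (forall t, a <= t -> is_derive t 1 f (df t)) ->
  (forall t, a < t -> t < b -> 0 <= df t) -> f a <= f b.
Proof.
move=> ab fd dfge0.
apply: (@ger0_derive1_ndecr _ f a b) => //.
- move=> t; rewrite in_itv/= => /andP[ta _].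
  by have [] := fd t (ltW ta).
- move=> t; rewrite in_itv/= => /andP[ta tb]; rewrite derive1E.
  by have [_ ->] := fd t (ltW ta); exact: dfge0.
- apply: derivable_within_continuous => t; rewrite in_itv/= => /andP[ta _].
  by have [] := fd t ta.
Qed.

Section FixedDegree.
Variable k : nat.
Let K : R := k.+1%:R.
Let x t := ell al k.+1 t.
Let y t := ell al k t.
(** The geometric mean of K and K + al. With the orthonormal normalisation it is the coupling
    coefficient in both equations [dx] and [dy], which gives the system its symmetry. *)
Let a : R := Num.sqrt (K * (K + al)).

Let K1 : 1 <= K. Proof. by rewrite /K ler1n. Qed.

Let K0 : 0 < K. Proof. exact: lt_le_trans K1. Qed.

Let a_ge0 : 0 <= a. Proof. exact: sqrtr_ge0. Qed.

Let a_sqr : a ^+ 2 = K * (K + al).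
Proof. by rewrite sqr_sqrtr// mulr_ge0 ?addr_ge0 ?(ltW K0). Qed.

Lemma XMderiv_lagpS : 'X * (lagp al k.+1)^`() = K *: (lagp al k.+1 - lagp al k).
Proof.
apply/polyP => -[|m]; rewrite coefXM coefZ coefB /=.
  by rewrite !coef_lagp !bin0 subrr mulr0.
rewrite coef_deriv !coef_lagp.
have h := mul_bin_diag k.+1 m; rewrite /= in h.
have {}h : K * 'C(k, m)%:R = m.+1%:R * 'C(k.+1, m.+1)%:R by rewrite -!natrM h.
have e : 'C(k.+1, m.+1)%:R = 'C(k, m.+1)%:R + 'C(k, m)%:R :> R by rewrite binS natrD.
rewrite -mulr_natr.
transitivity ((-1) ^+ m.+1 / gam al m.+1 * (m.+1%:R * 'C(k.+1, m.+1)%:R)); first by ring.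
by rewrite -h e; ring.
Qed.

Lemma XMderiv_lagp :
  'X * (lagp al k)^`() = (K + al) *: (lagp al k.+1 - lagp al k) + 'X * lagp al k.
Proof.
apply/polyP => -[|m]; rewrite coefD !coefXM coefZ coefB /=.
  by rewrite !coef_lagp !bin0 subrr mulr0 addr0.
rewrite coef_deriv !coef_lagp.
have h := mul_bin_left k m.
have {}h : m.+1%:R * 'C(k, m.+1)%:R = (k%:R - m%:R) * 'C(k, m)%:R :> R.
  rewrite -natrM h natrM; have [mk|km] := leqP m k; first by rewrite natrB.
  by rewrite bin_small// !mulr0.
have e : 'C(k.+1, m.+1)%:R = 'C(k, m.+1)%:R + 'C(k, m)%:R :> R by rewrite binS natrD.
have g : (gam al m)^-1 = (m%:R + al + 1) / gam al m.+1.
  rewrite gamS//; have h1 := gam_neq0 al0 m.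
  have h2 : m%:R + al + 1 != 0 by rewrite gt_eqF// ltr_wpDl ?kal_ge0.
  by field; rewrite h1 h2.
rewrite g e -mulr_natr.
transitivity ((-1) ^+ m.+1 / gam al m.+1 * (m.+1%:R * 'C(k, m.+1)%:R)); first by ring.
by rewrite h /K -natr1 exprS; ring.
Qed.

Let lagnorm_step1 : K * lagnorm al k.+1 = a * lagnorm al k.
Proof.
apply/eqP; rewrite -(@eqrXn2 _ 2)// ?mulr_ge0 ?(ltW K0) ?(ltW (lagnorm_gt0 al0 _))//.
rewrite !exprMn a_sqr !lagnorm_sqr// gamS// factS natrM -/K.
have f0 : k`!%:R != 0 :> R by rewrite pnatr_eq0 -lt0n fact_gt0.
have -> : k%:R + al + 1 = K + al by rewrite /K -natr1 addrAC.
have aux (P G F c : R) : P != 0 -> F != 0 -> P ^+ 2 * (c * G / (P * F)) = P * c * (G / F).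
  by move=> h1 h2; field; rewrite h1 h2.
by apply/eqP/aux => //; exact: lt0r_neq0.
Qed.

Let lagnorm_step2 : a * lagnorm al k.+1 = (K + al) * lagnorm al k.
Proof.
apply: (mulfI (lt0r_neq0 K0)).
by rewrite mulrCA lagnorm_step1 !mulrA -expr2 a_sqr.
Qed.

Lemma is_derive_horner (p : {poly R}) t : is_derive t 1 (horner p) (p^`()).[t].
Proof.
apply: DeriveDef; first exact: derivable_horner.
by rewrite -derive1E -derivE.
Qed.

Lemma is_derive_ell j t : is_derive t 1 (ell al j) (lagnorm al j * ((lagp al j)^`()).[t]).
Proof.
have -> : ell al j = fun t => lagnorm al j * (lagp al j).[t].
  by apply/funext => s; rewrite ellE.
exact: is_deriveZ (is_derive_horner _ _).
Qed.

Let dx t : 0 < t -> is_derive t 1 x ((K * x t - a * y t) / t).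
Proof.
move=> t0; have /is_derive_eq := is_derive_ell k.+1 t; apply.
have h : t * (lagp al k.+1)^`().[t] = K * ((lagp al k.+1).[t] - (lagp al k).[t]).
  by have := congr1 (horner^~ t) XMderiv_lagpS; rewrite /= hornerM hornerX hornerZ hornerD hornerN.
rewrite /x /y !ellE// [a * (_ * _)]mulrA -lagnorm_step1.
apply: (mulfI (lt0r_neq0 t0)); rewrite mulrCA h.
by field; rewrite gt_eqF.
Qed.

Let dy t : 0 < t -> is_derive t 1 y ((a * x t - (K + al - t) * y t) / t).
Proof.
move=> t0; have /is_derive_eq := is_derive_ell k t; apply.
have h : t * (lagp al k)^`().[t] =
    (K + al) * ((lagp al k.+1).[t] - (lagp al k).[t]) + t * (lagp al k).[t].
  have := congr1 (horner^~ t) XMderiv_lagp; rewrite /= hornerM hornerX hornerD hornerZ.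
  by rewrite hornerD hornerN hornerM hornerX.
rewrite /x /y !ellE// [a * (_ * _)]mulrA lagnorm_step2.
apply: (mulfI (lt0r_neq0 t0)); rewrite mulrCA h.
by field; rewrite gt_eqF.
Qed.

Let S t : R := weight al t * (x t ^+ 2 + y t ^+ 2).

(** Put X = x sqrt w, Y = y sqrt w and c = (2K + al - t)/2. Then t X' = c X - a Y and t Y' = a X - c
    Y, a Hamiltonian system in log t, and [H] is twice its Hamiltonian. It varies only through the
    explicit dependence of c on t. *)
Let H t : R := weight al t *
  (a * (x t ^+ 2 + y t ^+ 2) - (2 * K + al - t) * (x t * y t)).

Let U t : R := weight al t * x t ^+ 2.

Let dxx t (t0 : 0 < t) := is_deriveM (dx t0) (dx t0).
Let dyy t (t0 : 0 < t) := is_deriveM (dy t0) (dy t0).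
Let dxy t (t0 : 0 < t) := is_deriveM (dx t0) (dy t0).

Let dU t : 0 < t -> is_derive t 1 U
  (weight al t * (((2 * K + al - t) * x t ^+ 2 - 2 * a * (x t * y t)) / t)).
Proof.
move=> t0; have /is_derive_eq := is_deriveM (is_derive_weight al t0) (dxx t0); apply.
rewrite !fctE /GRing.scale/=.
by field; rewrite gt_eqF.
Qed.

(* The coefficients of x^2 and of y^2 in the derivative cancel. *)
Let dH t : 0 < t -> is_derive t 1 H (weight al t * (x t * y t)).
Proof.
move=> t0.
have dl : is_derive t 1 (fun t : R => 2 * K + al - t) (-1).
  have /is_derive_eq := is_deriveB (is_derive_cst (2 * K + al) t 1) (is_derive_id t (1 : R)).
  by apply; rewrite sub0r.
have /is_derive_eq := is_deriveM (is_derive_weight al t0)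
  (is_deriveB (is_deriveZ a (is_deriveD (dxx t0) (dyy t0))) (is_deriveM dl (dxy t0))).
apply.
rewrite -[X in _ + X *: _]/(a * (x t * x t + y t * y t) - (2 * K + al - t) * (x t * y t)).
rewrite /GRing.scale/= mulrfctE.
by field; rewrite gt_eqF.
Qed.

Let SP : {poly R} := (lagnorm al k.+1 *: lagp al k.+1) ^+ 2 + (lagnorm al k *: lagp al k) ^+ 2.

Let SE t : S t = weight al t * SP.[t].
Proof. by rewrite /S /x /y !ellE// /SP !(hornerD, hornerZ, horner_exp). Qed.

Let hl_integrable_S : hl_integrable S.
Proof. by apply: eq_hl_integrable (hl_integrable_weight_poly al0 SP) => t _; rewrite SE. Qed.

Let S_ge0 t : 0 <= S t.
Proof. by rewrite mulr_ge0 ?weight_ge0 ?addr_ge0 ?sqr_ge0. Qed.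

Let hl_int_S : hl_int S = 2.
Proof.
transitivity (dotw al x x + dotw al y y); last by rewrite !dotw_ell// !eqxx.
have h j : hl_integrable (fun t => weight al t * ell al j t * ell al j t).
  apply: eq_hl_integrable (hl_integrable_weight_poly al0
    ((lagnorm al j *: lagp al j) ^+ 2)) => t _.
  by rewrite ellE// horner_exp hornerZ expr2 !mulrA.
rewrite /dotw -!hl_intE -hl_intD; [|exact: h|exact: h].
by apply: eq_hl_int => t _; rewrite /S; ring.
Qed.

Let V t : R := Rintegral leb `]0, t] S.

Let hl_integrable_S_itv t : leb.-integrable `]0, t] (EFin \o S).
Proof.
apply: (integrableS _ _ _ hl_integrable_S); [exact: measurable_itv|exact: measurable_itv|].
exact: subset_itvl.
Qed.

Let continuous_S t : 0 < t -> {for t, continuous S}.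
Proof.
move=> t0; have -> : S = weight al \* horner SP by apply/funext => s; rewrite SE.
by apply: continuousM; [exact: continuous_weight|exact: continuous_horner].
Qed.

Let dV t : 0 < t -> is_derive t 1 V (S t).
Proof.
move=> t0; have tt : t < t + 1 by rewrite ltrDl.
have [h1 h2] := continuous_FTC1 tt (hl_integrable_S_itv (t + 1)) t0 (continuous_S t0).
by apply: (DeriveDef h1); rewrite -derive1E; exact: h2.
Qed.

Let V_ge0 t : 0 <= V t.
Proof. by apply: Rintegral_ge0 => s _; exact: S_ge0. Qed.

Let V_le2 t : V t <= 2.
Proof.
rewrite -hl_int_S hl_intE /V /Rintegral; apply: fine_le.
- exact: (integrable_fin_num _ (hl_integrable_S_itv t)).
- by apply: integrable_fin_num; [exact: measurable_itv|exact: hl_integrable_S].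
apply: ge0_subset_integral; [exact: measurable_itv|exact: measurable_itv| | |].
- exact: (measurable_int leb hl_integrable_S).
- by move=> s _; rewrite lee_fin.
- exact: subset_itvl.
Qed.

Let V_near0 C t : 0 < t -> (forall s, 0 < s -> s <= t -> S s <= C) -> V t <= C * t.
Proof.
move=> t0 hC.
have -> : C * t = Rintegral leb `]0, t] (fun=> C).
  rewrite Rintegral_cst; last exact: measurable_itv.
  transitivity (C * fine (leb `]0, t]%classic)); last by [].
  by rewrite lebesgue_measure_itv/= lte_fin t0 sube0.
apply: le_Rintegral; [exact: measurable_itv|exact: hl_integrable_S_itv| |].
- apply: (@integrableS _ _ _ leb `[0, t]); [exact: measurable_itv|exact: measurable_itv| |].
    exact: subset_itv_oc_cc.
  apply: continuous_compact_integrable; first exact: segment_compact.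
  by apply: continuous_subspaceT => s; exact: cst_continuous.
- by move=> s; rewrite /= in_itv/= => /andP[]; exact: hC.
Qed.

(** For al > 0 the weight vanishes at 0. For al = 0 one has a = K and both functions take the same
    value at 0, so that the form, there K (x - y)^2, vanishes. *)
Let H_cvg0 : H t @[t --> 0^'+] --> 0.
Proof.
pose p := lagnorm al k.+1 *: lagp al k.+1; pose q := lagnorm al k *: lagp al k.
pose E : {poly R} := a *: (p ^+ 2 + q ^+ 2) - ((2 * K + al)%:P - 'X) * (p * q).
have HE t : H t = weight al t * E.[t].
  rewrite /H /x /y !ellE// /E /p /q.
  by rewrite !(hornerD, hornerN, hornerM, hornerZ, horner_exp, hornerC, hornerX).
have e0 : weight al 0 * E.[0] = 0.
  have [alE|al_neq0] := eqVneq al 0; last by rewrite /weight powR0// !mul0r.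
  have aK : a = K.
    apply/eqP; rewrite -(@eqrXn2 _ 2) ?a_ge0 ?(ltW K0)//.
    by rewrite a_sqr alE addr0 expr2.
  have gE : lagnorm al k.+1 = lagnorm al k.
    by apply: (mulfI (lt0r_neq0 K0)); rewrite lagnorm_step1 aK.
  have pq : p.[0] = q.[0].
    by rewrite /p /q !hornerZ gE !horner_coef0 !coef_lagp !bin0.
  rewrite /E; clear E HE; move: p q pq => p q pq.
  rewrite !(hornerD, hornerN, hornerM, hornerZ, horner_exp, hornerC, hornerX).
  by rewrite pq aK [in 2 * K + al]alE; ring.
rewrite -[X in _ --> X]e0; under eq_fun do rewrite HE.
apply: cvgM; first exact: weight_cvg.
by apply: cvg_at_right_filter; exact: continuous_horner.
Qed.

Let H_le_V t : 0 < t -> H t <= V t / 2.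
Proof.
move=> t0; rewrite leNgt; apply/negP => HV.
have e0 : 0 < H t - V t / 2 by rewrite subr_gt0.
have mono s : 0 < s -> s <= t -> V s / 2 - H s <= V t / 2 - H t.
  move=> s0 st.
  apply: (@ndecr_is_derive (fun r => V r / 2 - H r)
    (fun r => S r / 2 - weight al r * (x r * y r)) s t st).
    move=> r sr; have r0 := lt_le_trans s0 sr.
    have dV2 : is_derive r 1 (fun r => V r / 2) (S r / 2).
      have /is_derive_eq := is_deriveM (dV r0) (is_derive_cst (2^-1 : R) r 1); apply.
      by rewrite scaler0 add0r /GRing.scale/= mulrC.
    exact: is_deriveB dV2 (dH r0).
  move=> r sr _.
  have -> : S r / 2 - weight al r * (x r * y r) = weight al r * ((x r - y r) ^+ 2 / 2).
    by rewrite /S; field.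
  by rewrite mulr_ge0 ?weight_ge0 ?divr_ge0 ?sqr_ge0.
(* Since [H] tends to 0 at 0, it falls below the assumed excess at some s; monotonicity of V/2 - H
   would then make V s negative. *)
have [s [s0 st Hs]] : exists s, [/\ 0 < s, s <= t & H s < H t - V t / 2].
  near (0 : R)^'+ => s; exists s; split.
  - by near: s; exact: nbhs_right_gt.
  - by near: s; exact: nbhs_right_le.
  - near: s; exact: (cvgr_lt _ H_cvg0).
have := mono s s0 st; have := V_ge0 s; lra.
Unshelve. all: end_near. Qed.

(** Half of it bounds the gap K + al/2 - a between the arithmetic and the geometric mean of K and K
    + al: the gap times K + al/2 + a >= 2K equals al^2/4. *)
Let b0 : R := al ^+ 2 / (4 * K).

Let a_lower : K + al / 2 - b0 / 2 <= a.
Proof.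
have Ka : K <= a.
  rewrite -(@ler_pXn2r _ 2)// ?nnegrE ?a_ge0 ?(ltW K0)// a_sqr expr2.
  by apply: ler_wpM2l; [exact: ltW|rewrite lerDl].
have : (K + al / 2 - a) * (2 * K) <= al ^+ 2 / 4.
  have e : (K + al / 2 - a) * (K + al / 2 + a) = al ^+ 2 / 4.
    by rewrite -subr_sqr a_sqr; field.
  have [h|h] := leP 0 (K + al / 2 - a).
    by rewrite -e; apply: ler_wpM2l => //; lra.
  apply: (@le_trans _ _ 0); [|by rewrite divr_ge0 ?sqr_ge0].
  by rewrite mulr_le0_ge0 ?(ltW h)// mulr_ge0 ?(ltW K0).
rewrite -ler_pdivlMr ?mulr_gt0// => h.
suff -> : b0 / 2 = al ^+ 2 / 4 / (2 * K).
  by move: h; move: (al ^+ 2 / 4 / (2 * K)) => z h; rewrite lerBlDr -lerBlDl.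
by rewrite /b0; field; exact: lt0r_neq0.
Qed.

(* Since S = V', this says that V / (t - b0) is nonincreasing up to 2K + alpha. *)
Let growth t : 0 < t -> t <= 2 * K + al -> (t - b0) * S t <= V t.
Proof.
move=> t0 tK; have h := H_le_V t0; have hw := weight_ge0 al t.
suff : (t - b0) / 2 * S t <= H t by lra.
(* With c = K + al/2 - t/2, nonnegative in this range, the form splits as (a - c)(x^2 + y^2) + c (x
   - y)^2, and [a_lower] gives a - c >= (t - b0)/2. *)
have -> : H t = weight al t * (a - (K + al / 2 - t / 2)) * (x t ^+ 2 + y t ^+ 2) +
    weight al t * ((2 * K + al - t) / 2 * (x t - y t) ^+ 2).
  by rewrite /H; field.
apply: ler_wpDr.
  by rewrite mulr_ge0// mulr_ge0 ?sqr_ge0// divr_ge0// subr_ge0.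
rewrite /S mulrCA -mulrA; apply: ler_wpM2l => //.
apply: ler_wpM2r; first by rewrite addr_ge0 ?sqr_ge0.
have := a_lower; lra.
Qed.

(** The junction between the explicit estimate and the differential inequality: K t1 does not depend
    on k, and the term al^2/2 makes t1 >= 2 b0, so t1 - b0 is comparable with t1. *)
Let t1 : R := (al ^+ 2 / 2 + 1) / K.

Let t1_gt0 : 0 < t1.
Proof. by rewrite divr_gt0// ltr_wpDl// divr_ge0 ?sqr_ge0. Qed.

Let b0_t1 : b0 <= t1 / 2.
Proof.
have -> : b0 = t1 / 2 - (2 * K)^-1.
  by rewrite /b0 /t1; field; exact: lt0r_neq0.
by rewrite gerBl invr_ge0 mulr_ge0 ?(ltW K0).
Qed.

(** By [growth], S t <= V t / (t - b0) <= V t1 / (t1 - b0); the latter is at most C t1 / (t1/2) =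
    2C. *)
Let S_middle C t : (forall s, 0 < s -> s <= t1 -> S s <= C) ->
  t1 <= t -> t <= 2 * K + al -> S t <= 2 * C.
Proof.
move=> hC tt1 tK; have t0 := lt_le_trans t1_gt0 tt1.
have pos s : t1 <= s -> 0 < s - b0.
  have := b0_t1; have := t1_gt0; lra.
have h : V t / (t - b0) <= V t1 / (t1 - b0).
  rewrite -lerN2.
  apply: (@ndecr_is_derive (fun s => - (V s / (s - b0)))
    (fun s => (V s - (s - b0) * S s) / (s - b0) ^+ 2) t1 t tt1).
    move=> s ts; have s0 := lt_le_trans t1_gt0 ts.
    have db : is_derive s 1 (fun r : R => r - b0) 1.
      have /is_derive_eq := is_deriveB (is_derive_id s (1 : R)) (is_derive_cst b0 s 1).
      by apply; rewrite subr0.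
    have n0 : s - b0 != 0 by rewrite lt0r_neq0 ?pos.
    have /is_derive_eq := is_deriveN (is_deriveM (dV s0)
      (@is_deriveV R (fun r => r - b0) s 1 1 n0 db)); apply.
    by rewrite /GRing.scale/=; field.
  move=> s ts st; rewrite divr_ge0 ?sqr_ge0// subr_ge0.
  by apply: growth; [exact: lt_trans t1_gt0 ts|exact: ltW (lt_le_trans st tK)].
have Vt1 : V t1 <= C * t1 by exact: V_near0.
have := growth t0 tK; rewrite mulrC -ler_pdivlMr ?pos// => /le_trans; apply.
apply: (le_trans h); rewrite ler_pdivrMr ?pos//; apply: (le_trans Vt1).
have C0 : 0 <= C by exact: le_trans (S_ge0 t1) (hC _ t1_gt0 (lexx _)).
rewrite (_ : 2 * C * (t1 - b0) = C * (2 * (t1 - b0))); last by ring.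
by apply: ler_wpM2l => //; have := b0_t1; lra.
Qed.

Let a_upper : a <= K + al / 2.
Proof.
rewrite -(@ler_pXn2r _ 2)// ?nnegrE ?a_ge0//; last first.
  by rewrite addr_ge0 ?divr_ge0 ?(ltW K0).
by rewrite a_sqr -subr_ge0 (_ : _ - _ = (al / 2) ^+ 2) ?sqr_ge0//; field.
Qed.

(* Beyond 2K + alpha the derivative of U is controlled by S, which is
   integrable; so U is small somewhere to the right and cannot be large here. *)
Let U_far t : 2 * K + al <= t -> U t <= 5.
Proof.
move=> tK; have t0 : 0 < t by apply: lt_le_trans tK; rewrite ltr_pwDl ?mulr_gt0.
have tt : t < t + 1 by rewrite ltrDl.
have dVt s : t <= s -> is_derive s 1 V (S s).
  by move=> ts; apply: dV; exact: lt_le_trans ts.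
(* [V] grows by at most 2 over a unit interval, so S is at most 2 at some T in it. *)
have [T] : exists2 T, T \in `]t, (t + 1)[ & V (t + 1) - V t = S T * (t + 1 - t).
  apply: MVT => //.
    by move=> s; rewrite in_itv/= => /andP[ts _]; apply: dVt; exact: ltW.
  apply: derivable_within_continuous => s; rewrite in_itv/= => /andP[ts _].
  by have [] := dVt s ts.
rewrite in_itv/= addrAC subrr add0r mulr1 => /andP[tT _] VS.
have ST : S T <= 2 by rewrite -VS; have := V_le2 (t + 1); have := V_ge0 t; lra.
have US : U T <= S T.
  by rewrite /U /S; apply: ler_wpM2l; rewrite ?weight_ge0// lerDl sqr_ge0.
(* The bound 5 is 2, for U at T, plus 3/2 times the largest possible increase 2 of V. *)
have : U t + V t * (3 / 2) <= U T + V T * (3 / 2).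
  apply: (@ndecr_is_derive (fun s => U s + V s * (3 / 2))
    (fun s => weight al s * (((2 * K + al - s) * x s ^+ 2 - 2 * a * (x s * y s)) / s)
       + S s * (3 / 2)) t T (ltW tT)).
    move=> s ts; have s0 := lt_le_trans t0 ts.
    have dV2 : is_derive s 1 (fun r => V r * (3 / 2)) (S s * (3 / 2)).
      have /is_derive_eq := is_deriveM (dV s0) (is_derive_cst (3 / 2 : R) s 1); apply.
      by rewrite scaler0 add0r /GRing.scale/= mulrC.
    exact: is_deriveD (dU s0) dV2.
  move=> s ts _; have s0 := lt_trans t0 ts.
  (* All terms on the right are nonnegative, because s/2 >= K + al/2 >= a. *)
  have -> : weight al s * (((2 * K + al - s) * x s ^+ 2 - 2 * a * (x s * y s)) / s)
       + S s * (3 / 2) = weight al s / s * (((2 * K + al) * x s ^+ 2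
         + (s / 2 - a) * (x s ^+ 2 + y s ^+ 2) + a * (x s - y s) ^+ 2 + s * y s ^+ 2)).
    by rewrite /S; field; exact: lt0r_neq0.
  have ha : 0 <= s / 2 - a by have := a_upper; lra.
  apply: mulr_ge0; first by rewrite divr_ge0 ?weight_ge0 ?(ltW s0).
  have q r : 0 <= r ^+ 2 :> R by exact: sqr_ge0.
  apply: addr_ge0; last by apply: mulr_ge0; [exact: ltW|].
  apply: addr_ge0; last by apply: mulr_ge0.
  apply: addr_ge0; last by apply: mulr_ge0 => //; exact: addr_ge0.
  by apply: mulr_ge0 => //; rewrite addr_ge0// mulr_ge0// ltW.
have := V_le2 T; have := V_ge0 t; lra.
Qed.

(** The hypothesis bounds S by 2C up to [t1], [S_middle] doubles this, and 5 comes from [U_far]. The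
    constant C is common to all degrees, hence so is the conclusion. *)
Lemma lagfS_sqr_le C t : 0 < t -> (forall s j, 0 < s ->
    (maxn 1 j)%:R * s <= al ^+ 2 / 2 + 1 -> lagf al j s ^+ 2 <= C) ->
  lagf al k.+1 t ^+ 2 <= 4 * C + 5.
Proof.
move=> t0 hC.
have SE2 s : S s = lagf al k.+1 s ^+ 2 + lagf al k s ^+ 2.
  by rewrite /S /lagf ![(_ * sqrtw _ _) ^+ 2]exprMn sqrtw_sqr -mulrDl mulrC.
have hS s : 0 < s -> s <= t1 -> S s <= 2 * C.
  move=> s0 st; have sK : K * s <= al ^+ 2 / 2 + 1 by rewrite mulrC -ler_pdivlMr.
  have h1 : lagf al k.+1 s ^+ 2 <= C by apply: hC => //; rewrite (maxn_idPr _).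
  have h2 : lagf al k s ^+ 2 <= C.
    apply: hC => //; apply: le_trans sK; apply: ler_wpM2r; first exact: ltW.
    by rewrite ler_nat geq_max leqnSn.
  by rewrite SE2; lra.
have C0 : 0 <= C.
  by have := hS _ t1_gt0 (lexx _); have := S_ge0 t1; lra.
have le_S : lagf al k.+1 t ^+ 2 <= S t by rewrite SE2 lerDl sqr_ge0.
have [tt1|tt1] := leP t t1; first by have := hS _ t0 tt1; lra.
have [tK|tK] := leP t (2 * K + al).
  by have := S_middle hS (ltW tt1) tK; lra.
have := U_far (ltW tK).
have -> : U t = lagf al k.+1 t ^+ 2 by rewrite /U /lagf [(_ * sqrtw _ _) ^+ 2]exprMn sqrtw_sqr mulrC.
lra.
Qed.

End FixedDegree.

Theorem lagf_bounded : exists2 B, 0 < B &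
  forall k t, 0 < t -> `|lagf al k t| <= B.
Proof.
have c0 : 0 < al ^+ 2 / 2 + 1 by rewrite ltr_wpDl// divr_ge0 ?sqr_ge0.
have [C C0 hC] := lagf_upper_near0 al0 c0.
have [K K0 hK] := powR_exp_bound al0 (@ltr01 R).
pose M := 4 * C + 5 + K / gam al 0.
have M0 : 0 < M.
  by rewrite /M addr_gt0 ?divr_gt0 ?gam_gt0//; lra.
exists (Num.sqrt M); first by rewrite sqrtr_gt0.
move=> k t t0; rewrite -sqrtr_sqr; apply: ler_wsqrtr.
have h0 : 0 <= K / gam al 0 by rewrite divr_ge0 ?(ltW K0) ?(ltW (gam_gt0 _ _)).
case: k => [|k]; last first.
  apply: (@le_trans _ _ (4 * C + 5)); last by rewrite lerDl.
  by apply: lagfS_sqr_le => // s j s0 js; exact: hC.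
(* Degree 0 is never the upper member of a pair. Its explicit form and t^al <= K e^t account for the
   last summand of [M]. *)
apply: ler_wpDl; first by lra.
rewrite lagf_sqr// lagnorm_sqr// fact0 divr1.
have -> : (lagp al 0).[t] = (gam al 0)^-1.
  by rewrite horner_lagp big_ord_recl big_ord0 bin0 expr0 mulr1 mul1r addr0.
have -> : gam al 0 * (gam al 0)^-1 ^+ 2 * weight al t = weight al t / gam al 0.
  by field; exact: gam_neq0.
rewrite ler_pM2r ?invr_gt0 ?gam_gt0//.
apply: le_trans (ler_wpM2r (expR_ge0 _) (hK t (ltW t0))) _.
by rewrite -mulrA -expRD mul1r subrr expR0 mulr1.
Qed.

End UniformBound.

(** * Functions with vanishing moments *)

Section Completeness.
Context {R : realType}.
Implicit Types (t x z h c : R) (k m n N : nat).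
Local Notation leb := (@lebesgue_measure R).
Local Notation D := (@halfline R).

Lemma series_exp_le x N : 0 <= x -> \sum_(m < N) x ^+ m / m`!%:R <= expR x.
Proof.
move=> x0; rewrite -(big_mkord xpredT (fun m => x ^+ m / m`!%:R)).
apply: (nondecreasing_cvgn_le _ (is_cvg_series_exp_coeff x)).
apply: nondecreasing_series => i _ _.
by rewrite /exp_coeff /= divr_ge0// exprn_ge0.
Qed.

Lemma series_exp_cvg x : \sum_(m < N) x ^+ m / m`!%:R @[N --> \oo] --> expR x.
Proof.
have := is_cvg_series_exp_coeff x.
under eq_fun do rewrite -(big_mkord xpredT (fun m => x ^+ m / m`!%:R)).
exact.
Qed.

Lemma one_minus_pow_ge (y : R) m : 0 <= y <= 1 -> 1 - m%:R * y <= (1 - y) ^+ m.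
Proof.
move=> /andP[y0 y1]; elim: m => [|m IH]; first by rewrite mul0r subr0 expr0.
rewrite exprSr; apply: (@le_trans _ _ ((1 - m%:R * y) * (1 - y))); last first.
  by apply: ler_wpM2r => //; rewrite subr_ge0.
have : 0 <= m%:R * y ^+ 2 by rewrite mulr_ge0 ?sqr_ge0.
by rewrite -natr1; lra.
Qed.

Lemma one_minus_pow_le (y : R) m : y <= 1 -> (1 - y) ^+ m <= expR (- (m%:R * y)).
Proof.
move=> y1; rewrite -mulrN expRM_natl; apply: lerXn2r; rewrite ?nnegrE ?expR_ge0 ?subr_ge0//.
exact: expR_ge1Dx.
Qed.

Variable phi : R -> R.
Hypothesis mphi : measurable_fun D phi.
Hypothesis hphi : forall n, hl_integrable (fun t => `|phi t| * t ^+ n * expR (4^-1 * t)).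
Hypothesis phi0 : forall n, hl_int (fun t => phi t * t ^+ n) = 0.

Let measurable_phi_exp n z : measurable_fun D (fun t => phi t * t ^+ n * expR (- (z * t))).
Proof.
apply: measurable_funM; first exact: measurable_funM.
apply: (measurable_funS measurableT) => //; apply: measurableT_comp => //.
by apply: measurableT_comp => //; exact: measurable_funM.
Qed.

Let hl_integrable_phi n z : 0 <= z -> hl_integrable (fun t => phi t * t ^+ n * expR (- (z * t))).
Proof.
move=> z0; apply: hl_integrable_le (hphi n) => // t t0.
rewrite !normrM (ger0_norm (expR_ge0 _)) normrX (gtr0_norm t0).
apply: ler_wpM2l; first by rewrite mulr_ge0 ?exprn_ge0// ltW.
by rewrite ler_expR; apply: (@le_trans _ _ 0); rewrite ?oppr_le0 ?mulr_ge0 ?(ltW t0).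
Qed.

(** The series of e^(-ht) may be integrated term by term because |phi| t^n e^(t/4) dominates its
    partial sums. The same function dominates for every z >= 0, which is why the admissible step
    does not depend on z. All moments are carried along, since the next step needs them. *)
Let exp_step z h : 0 <= z -> 0 <= h -> h <= 4^-1 ->
  (forall n, hl_int (fun t => phi t * t ^+ n * expR (- (z * t))) = 0) ->
  forall n, hl_int (fun t => phi t * t ^+ n * expR (- ((z + h) * t))) = 0.
Proof.
move=> z0 h0 h4 Pz n.
pose F N t := phi t * t ^+ n * expR (- (z * t)) * \sum_(m < N) (- (h * t)) ^+ m / m`!%:R.
have FE N t : F N t =
    \sum_(m < N) ((- h) ^+ m / m`!%:R) * (phi t * t ^+ (n + m) * expR (- (z * t))).
  rewrite /F mulr_sumr; apply: eq_bigr => m _.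
  by rewrite -(mulNr h t) [(- h * t) ^+ m]exprMn exprD; ring.
apply: (@dominated_hl_int_cst0 R F _ (fun t => `|phi t| * t ^+ n * expR (4^-1 * t))).
- move=> N; rewrite (_ : F N = fun t => \sum_(m < N) ((- h) ^+ m / m`!%:R) *
      (phi t * t ^+ (n + m) * expR (- (z * t)))); last exact/funext.
  by apply: measurable_sum => m; exact: measurable_funM.
- exact: measurable_phi_exp.
- apply: aeW => t t0; rewrite mulrDl opprD expRD mulrA.
  by apply: cvgM; [exact: cvg_cst|exact: series_exp_cvg].
- exact: hphi.
- move=> N t t0; rewrite /F -mulrA normrM normrM normrX (gtr0_norm t0).
  apply: ler_wpM2l; first by rewrite mulr_ge0 ?exprn_ge0// ltW.
  rewrite normrM (ger0_norm (expR_ge0 _)).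
  apply: (@le_trans _ _ (1 * expR (h * t))); last first.
    by rewrite mul1r ler_expR ler_pM2r.
  apply: ler_pM; [exact: expR_ge0|exact: normr_ge0| |].
    by rewrite expR_le1 oppr_le0 mulr_ge0 ?(ltW t0).
  apply: (le_trans (ler_norm_sum _ _ _)).
  apply: le_trans (series_exp_le N (mulr_ge0 h0 (ltW t0))).
  apply: ler_sum => i _.
  by rewrite normrM normrX normrN (ger0_norm (mulr_ge0 h0 (ltW t0))) ger0_norm// invr_ge0.
- move=> N; under eq_hl_int do rewrite FE.
  rewrite hl_int_sum; last by move=> i; exact/hl_integrableZ/hl_integrable_phi.
  by rewrite big1// => i _; rewrite hl_intZ ?Pz ?mulr0//; exact: hl_integrable_phi.
Qed.

Lemma laplace_eq0 z : 0 <= z -> hl_int (fun t => phi t * expR (- (z * t))) = 0.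
Proof.
move=> z0; suff P : forall k z, 0 <= z -> z <= k%:R * 4^-1 ->
    forall n, hl_int (fun t => phi t * t ^+ n * expR (- (z * t))) = 0.
  have zk : z <= (Num.truncn (4 * z)).+1%:R * 4^-1.
    have := truncnS_gt (4 * z); lra.
  by rewrite -(P _ z z0 zk 0%N); apply: eq_hl_int => t _; rewrite expr0 mulr1.
have P0 n : hl_int (fun t => phi t * t ^+ n * expR (- (0 * t))) = 0.
  by rewrite -[RHS](phi0 n); apply: eq_hl_int => t _; rewrite mul0r oppr0 expR0 mulr1.
elim=> [|k IH] {z0}z z0 zk n.
  have -> : z = 0 by apply/eqP; rewrite eq_le z0 andbT; move: zk; rewrite mul0r.
  exact: P0.
have [z4|z4] := leP z 4^-1.
  by have := exp_step (lexx 0) z0 z4 P0 n; rewrite add0r.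
have zz : 0 <= z - 4^-1 by rewrite subr_ge0 ltW.
have zk' : z - 4^-1 <= k%:R * 4^-1 by move: zk; rewrite -natr1; lra.
have h40 : 0 <= 4^-1 :> R by rewrite invr_ge0.
by have := exp_step zz h40 (lexx _) (IH _ zz zk') n; rewrite subrK.
Qed.

Let hl_integrable_phi1 : hl_integrable phi.
Proof.
apply: eq_hl_integrable (hl_integrable_phi 0 (lexx 0)) => t _.
by rewrite expr0 mulr1 mul0r oppr0 expR0 mulr1.
Qed.

(* The sequence (1 - exp(-z n t))^(2^n), with z = ln 2 / c, is bounded by 1 and
   tends to the indicator function of t > c, except at t = c. *)
Lemma tail_eq0 c : 0 < c -> Rintegral leb `]c, +oo[ phi = 0.
Proof.
move=> c0; pose z := ln 2 / c.
have ln2 : 0 < ln (2 : R) by rewrite ln_gt0// ltr1n.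
have z0 : 0 < z by rewrite divr_gt0.
have zc : z * c = ln 2 by rewrite /z divfK// gt_eqF.
have -> : `]c, +oo[%classic = D `&` `]c, +oo[%classic.
  apply/seteqP; split => [t|t [_]//]; rewrite /= in_itv/= andbT => ct.
  by split=> //; apply/halflineP; exact: lt_trans ct.
rewrite Rintegral_mkcondr -hl_intE.
pose F n t := phi t * (1 - expR (- (z * n%:R * t))) ^+ (2 ^ n).
have yle n t : 0 < t -> 0 <= expR (- (z * n%:R * t)) <= 1.
  move=> t0; rewrite expR_ge0 expR_le1 oppr_le0.
  by apply: mulr_ge0; [apply: mulr_ge0; [exact: ltW|exact: ler0n]|exact: ltW].
(* The base 2 e^(-zt) is below 1 exactly for t > c, as z c = ln 2. On that side (1 - y)^m >= 1 - m y
   gives the limit 1; on the other, (1 - y)^m <= e^(-my) gives 0. *)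
have qE n t : (2 ^ n)%:R * expR (- (z * n%:R * t)) = (2 * expR (- (z * t))) ^+ n.
  by rewrite natrX exprMn -expRM_natl; congr (_ * expR _); ring.
apply: (@dominated_hl_int_cst0 R F _ (fun t => `|phi t|)).
- move=> n; apply: measurable_funM => //.
  apply: measurable_funX; apply: (measurable_funS measurableT) => //.
  apply: measurable_funB => //; apply: measurableT_comp => //.
  by apply: measurableT_comp => //; exact: measurable_funM.
- have : measurable_fun D (phi \_ `]c, +oo[).
    apply/measurable_restrict; [exact: measurable_itv|exact: measurable_itv|].
    by apply: measurable_funS mphi; [exact: measurable_itv|exact: subIsetl].
  exact.
- exists [set c]; split; first exact: measurable_set1.
    exact: lebesgue_measure_set1.
  move=> t; apply: contra_notP => /eqP tc t0.
  rewrite patchE; case: ifPn.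
    rewrite inE/= in_itv/= andbT => ct.
    rewrite -[X in _ --> X]mulr1; apply: cvgM; first exact: cvg_cst.
    have q1 : `|2 * expR (- (z * t))| < 1.
      rewrite ger0_norm ?mulr_ge0 ?expR_ge0// -(lnK (_ : 2 \in Num.pos)) ?posrE//.
      by rewrite -expRD expR_lt1 -zc; nra.
    apply: (@squeeze_cvgr _ _ _ _ (fun n => 1 - (2 * expR (- (z * t))) ^+ n) (cst 1)).
    + apply: nearW => n; rewrite -qE one_minus_pow_ge ?yle//=.
      have /andP[h1 h2] := yle n t t0.
      by apply: exprn_ile1; rewrite ?subr_ge0// gerBl.
    + rewrite -[X in _ --> X]subr0; apply: cvgB; first exact: cvg_cst.
      exact: cvg_expr.
    + exact: cvg_cst.
  rewrite notin_setE/= in_itv/= andbT => /negP; rewrite -leNgt => tc'.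
  have {tc tc'} tc : t < c by rewrite lt_neqAle tc'; rewrite andbT.
  rewrite -[X in _ --> X](mulr0 (phi t)); apply: cvgM; first exact: cvg_cst.
  have q1 : `|(2 * expR (- (z * t)))^-1| < 1.
    rewrite ger0_norm ?invr_ge0 ?mulr_ge0 ?expR_ge0// -(lnK (_ : 2 \in Num.pos)) ?posrE//.
    by rewrite -expRD -expRN expR_lt1 -zc; nra.
  apply: (@squeeze_cvgr _ _ _ _ (cst 0) (fun n => (2 * expR (- (z * t)))^-1 ^+ n)).
  + apply: nearW => n /=; have /andP[h1 h2] := yle n t t0.
    rewrite exprn_ge0 ?subr_ge0//=; apply: (le_trans (one_minus_pow_le _ h2)).
    rewrite qE expRN exprVn lef_pV2 ?posrE ?expR_gt0 ?exprn_gt0 ?mulr_gt0 ?expR_gt0//.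
    by apply: le_trans (expR_ge1Dx _); rewrite lerDr.
  + exact: cvg_cst.
  + exact: cvg_expr.
- exact: hl_integrable_norm.
- move=> n t t0; rewrite /F normrM ler_piMr// normrX.
  have /andP[h1 h2] := yle n t t0.
  by apply: exprn_ile1 => //; rewrite ger0_norm ?subr_ge0// gerBl.
(* The binomial expansion leaves only values of the Laplace transform at the points z n i >= 0. *)
- move=> n; pose a i : R := (-1) ^+ i * 'C(2 ^ n, i)%:R.
  have FE t : F n t = \sum_(i < (2 ^ n).+1) a i * (phi t * expR (- (z * n%:R * i%:R * t))).
    rewrite /F exprBn mulr_sumr; apply: eq_bigr => i _.
    rewrite expr1n mulr1 -expRM_natl -mulr_natr /a.
    have -> : i%:R * - (z * n%:R * t) = - (z * n%:R * i%:R * t) by ring.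
    by ring.
  have zi i : 0 <= z * n%:R * i%:R by exact: (mulr_ge0 (mulr_ge0 (ltW z0) (ler0n _ _)) (ler0n _ _)).
  have hi i : hl_integrable (fun t => phi t * expR (- (z * n%:R * i%:R * t))).
    by apply: eq_hl_integrable (hl_integrable_phi 0 (zi i)) => t _; rewrite expr0 mulr1.
  under eq_hl_int do rewrite FE.
  rewrite hl_int_sum; last by move=> i; exact: hl_integrableZ.
  by rewrite big1// => i _; rewrite hl_intZ// laplace_eq0// mulr0.
Qed.

(** The integrals over ]0, x] vanish, being the total integral minus a tail. By Lebesgue
    differentiation [phi] is almost everywhere the derivative of this zero primitive. *)
Theorem ae_eq0_of_moments : {ae leb, forall t, 0 < t -> phi t = 0}.
Proof.
have mD : @measurable _ (measurableTypeR R) D by exact: measurable_itv.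
have F0 x : Rintegral leb `]0, x] (phi \_ D) = 0.
  transitivity (Rintegral leb `]0, x] phi).
    apply: eq_Rintegral => t /set_mem; rewrite /= in_itv/= => /andP[t0 _].
    by rewrite mem_set//; exact/halflineP.
  have [x0|x0] := leP x 0.
    by rewrite set_itv_ge ?Rintegral_set0// bnd_simp -leNgt.
  have := @Rintegral_itvB R phi (BRight 0) +oo%O x hl_integrable_phi1 _ _.
  rewrite -[X in X - _]/(Rintegral leb D phi) -hl_intE tail_eq0//.
  have -> : hl_int phi = 0 by rewrite -[RHS](phi0 0); apply: eq_hl_int => t _; rewrite expr0 mulr1.
  rewrite sub0r => /(_ _ _)/eqP; rewrite oppr_eq0 => h.
  by apply/eqP/h => //; rewrite bnd_simp ltW.
have locphi := integrable_locally mD hl_integrable_phi1.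
have intphi y : leb.-integrable [set` Interval (BRight 0) (BRight y)] (EFin \o (phi \_ D)).
  have h : leb.-integrable D (EFin \o (phi \_ D)).
    by apply: eq_hl_integrable hl_integrable_phi1 => t t0; rewrite patchE mem_set//; exact/halflineP.
  apply: (integrableS _ _ _ h); [exact: measurable_itv|exact: measurable_itv|].
  exact: subset_itvl.
have := FTC1 intphi locphi; apply: filterS; first exact: (ae_filter_ringOfSetsType leb).
move=> t h t0.
have [_] := h t0; under eq_fun do rewrite F0.
by rewrite derive1_cst patchE mem_set//; exact/halflineP.
Qed.

End Completeness.

(** * Weighted sequence classes and their tails *)

Section SummableTails.
Context {R : realType}.
Implicit Types (mu nu r d : R) (s p : \bar R) (k n m N : nat) (c : nat -> R).

Local Notation max1 k := ((maxn 1 k)%:R : R) (only parsing).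

Lemma maxn1_ge1 k : 1 <= (max1 k).
Proof. by rewrite ler1n leq_maxl. Qed.

Lemma maxn1_gt0 k : 0 < (max1 k).
Proof. exact: lt_le_trans (maxn1_ge1 k). Qed.

Lemma powR_maxn1_anti k n (e : R) : 0 <= e -> (k <= n)%N -> (max1 n) `^ (- e) <= (max1 k) `^ (- e).
Proof.
move=> e0 kn; rewrite !powRN lef_pV2 ?posrE ?powR_gt0 ?maxn1_gt0//.
apply: ge0_ler_powR; rewrite ?nnegrE//.
by rewrite ler_nat geq_max leq_maxl/=; exact: leq_trans kn (leq_maxr _ _).
Qed.

(** With e = r - 1, the inequality (1 - 1/x)^(-e) >= 1 + e/x bounds x^(-r) by ((x-1)^(-e) -
    x^(-e))/e, and the sum telescopes. *)
Lemma sum_powRN_bounded r : 1 < r -> exists2 Z, 0 < Z &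
  forall n, \sum_(k < n) (max1 k) `^ (- r) <= Z.
Proof.
move=> r1; pose e := r - 1; have e0 : 0 < e by rewrite subr_gt0.
have step n : n.+2%:R `^ (- r) <= (n.+1%:R `^ (- e) - n.+2%:R `^ (- e)) / e :> R.
  set x : R := n.+2%:R; have x0 : 0 < x by rewrite ltr0n.
  have x1 : 0 < 1 - x^-1.
    by rewrite subr_gt0 invf_lt1// /x ltr1n.
  have -> : n.+1%:R = x * (1 - x^-1) :> R.
    rewrite mulrBr mulr1 mulfV ?gt_eqF// /x -[n.+2]addn1 natrD; ring.
  rewrite (powRM _ (ltW x0) (ltW x1)).
  have h : 1 + e / x <= (1 - x^-1) `^ (- e).
    rewrite /powR gt_eqF//; apply: le_trans (expR_ge1Dx _).
    rewrite lerD2l mulNr -mulrN; apply: ler_wpM2l; first exact: ltW.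
    rewrite lerNr; apply: (@le_ln1Dx _ (- x^-1)).
    by rewrite ltrN2 -subr_gt0.
  rewrite ler_pdivlMr//.
  have -> : x `^ (- r) * e = x `^ (- e) * (1 + e / x) - x `^ (- e).
    have -> : - r = - e + - 1 by rewrite /e; ring.
    rewrite powRD ?(gt_eqF x0) ?implybT// powR_inv1 ?(ltW x0)//.
    by field; rewrite gt_eqF.
  by rewrite lerD2r; apply: ler_wpM2l => //; exact: powR_ge0.
(* The indices 0 and 1 each contribute 1 because of [maxn 1]; telescoping starts at 2. *)
have bound n : \sum_(k < n.+2) (max1 k) `^ (- r) <= 2 + (1 - n.+1%:R `^ (- e)) / e.
  elim: n => [|n IH].
    by rewrite !big_ord_recr big_ord0 /= (_ : maxn 1 0 = 1%N)// (_ : maxn 1 1 = 1%N)//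
      !powR1 subrr mul0r; lra.
  rewrite big_ord_recr/=; apply: le_trans (lerD IH (step n)) _.
  by rewrite -addrA -mulrDl; apply: lerD => //; rewrite ler_pM2r ?invr_gt0//; lra.
exists (2 + e^-1); first by rewrite ltr_wpDr// invr_ge0 ltW.
move=> n; apply: (@le_trans _ _ (\sum_(k < n.+2) (max1 k) `^ (- r))).
  by rewrite 2!big_ord_recr /= -addrA lerDl addr_ge0 ?powR_ge0.
apply: le_trans (bound n) _; rewrite lerD2l mulrBl mul1r gerBl.
by rewrite divr_ge0 ?powR_ge0// ltW.
Qed.

(** The condition on the coefficients is phrased by finite sums, so that estimates stay in the
    reals; [smnorm_le1P] links it to the norm of the class. *)
Definition seqW s mu c : Prop :=
  match s with
  | r%:E => forall n, \sum_(k < n) ((max1 k) `^ mu * `|c k|) `^ r <= 1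
  | +oo%E => forall k, (max1 k) `^ mu * `|c k| <= 1
  | -oo%E => True
  end.

Lemma recip_EFin r : 1 <= r -> recip r%:E = r^-1.
Proof. by move=> r1; rewrite /recip inver gt_eqF// (lt_le_trans ltr01). Qed.

Lemma recipy : recip +oo%E = 0 :> R.
Proof. by rewrite /recip invey. Qed.

Lemma powR_maxn1_split k nu mu : (max1 k) `^ (- mu) = (max1 k) `^ (- (mu - nu)) * (max1 k) `^ (- nu).
Proof.
by rewrite -powRD ?(gt_eqF (maxn1_gt0 _)) ?implybT//; congr (_ `^ _); ring.
Qed.

(* Writing mu = d + nu with 1 - 1/s < nu < mu, the factor k^(-nu) is absorbed by
   Young's inequality into a fixed summable sequence z. *)
Lemma seqW_termwise s mu : (1 <= s)%E -> 0 < mu -> 1 - recip s < mu ->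
  exists d A, [/\ 0 < d, 0 < A & forall c, seqW s mu c ->
    exists2 b : nat -> R, (forall k, 0 <= b k) /\ (forall n, \sum_(k < n) b k <= A) &
      forall k, `|c k| <= (max1 k) `^ (- d) * b k].
Proof.
have cE c k : `|c k| = (max1 k) `^ (- mu) * ((max1 k) `^ mu * `|c k|).
  by rewrite mulrA powRN mulVf ?mul1r// gt_eqF// powR_gt0// maxn1_gt0.
have y0 c k : 0 <= (max1 k) `^ mu * `|c k| by rewrite mulr_ge0 ?powR_ge0.
case: s => [r||]//; last first.
  move=> _ mu0; rewrite recipy subr0 => mu1.
  pose nu := (1 + mu) / 2; have nu1 : 1 < nu by rewrite /nu; lra.
  have [Z Z0 hZ] := sum_powRN_bounded nu1.
  exists (mu - nu), Z; split; [by rewrite /nu; lra|exact: Z0|].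
  move=> c hc; exists (fun k => (max1 k) `^ (- nu)).
    by split=> // k; exact: powR_ge0.
  move=> k; rewrite cE -powR_maxn1_split.
  by rewrite ler_piMr ?powR_ge0//; exact: hc.
rewrite lee_fin => r1 mu0; rewrite recip_EFin// => mur.
(* For r = 1 the conjugate exponent is infinite. The weighted coefficients are then summable
   themselves, and all of mu goes into the rate. *)
have [r1E|r1N] := eqVneq r 1.
  exists mu, 1; split => // c hc; exists (fun k => (max1 k) `^ mu * `|c k|).
    split=> // n; apply: le_trans (hc n); apply: ler_sum => k _.
    by rewrite r1E powRr1.
  by move=> k; rewrite {1}cE.
have {}r1 : 1 < r by rewrite lt_neqAle eq_sym r1N.
have r0 : 0 < r by exact: lt_trans r1.
have ri1 : r^-1 < 1 by rewrite invf_lt1.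
have r10 : 0 < 1 - r^-1 by rewrite subr_gt0.
(* [nu] is midway between 1 - 1/r and mu, which leaves mu - nu > 0 for the rate. As [q] is conjugate
   to r, nu q > 1, so the q-th power of k^(-nu) in Young's inequality is summable. *)
pose nu := ((1 - r^-1) + mu) / 2; pose q := (1 - r^-1)^-1.
have q0 : 0 < q by rewrite invr_gt0.
have nuq : 1 < nu * q.
  by rewrite /q ltr_pdivlMr// mul1r /nu; lra.
have [Z Z0 hZ] := sum_powRN_bounded nuq.
exists (mu - nu), (1 + Z); split; [by rewrite /nu; lra|by lra|].
move=> c hc; exists (fun k => ((max1 k) `^ mu * `|c k|) `^ r + (max1 k) `^ (- (nu * q))).
  split=> [k|n]; first by rewrite addr_ge0 ?powR_ge0.
  by rewrite big_split/=; apply: lerD; [exact: hc|exact: hZ].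
move=> k; rewrite [leLHS]cE (powR_maxn1_split k nu) -mulrA.
apply: ler_wpM2l; first exact: powR_ge0.
have pq : r^-1 + q^-1 = 1 by rewrite /q invrK; ring.
have := conjugate_powR (y0 c k) (powR_ge0 (max1 k) (- nu)) r0 q0 pq.
rewrite mulrC -powRrM mulNr => /le_trans; apply.
apply: lerD.
  by rewrite ler_piMr ?powR_ge0// ltW.
have q1 : q^-1 <= 1 by rewrite -pq lerDr invr_ge0 ltW.
by rewrite ler_piMr ?powR_ge0.
Qed.

Lemma seqW_tail s mu : (1 <= s)%E -> 0 < mu -> 1 - recip s < mu ->
  exists d A, [/\ 0 < d, 0 < A & forall c, seqW s mu c ->
    forall N n, \sum_(N <= k < n) `|c k| <= A * (max1 N) `^ (- d)].
Proof.
move=> s1 mu0 smu; have [d [A [d0 A0 h]]] := seqW_termwise s1 mu0 smu.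
exists d, A; split=> // c /h[b [b0 bA] cb] N n.
apply: (@le_trans _ _ (\sum_(N <= k < n) (max1 N) `^ (- d) * b k)).
  rewrite big_nat_cond [leRHS]big_nat_cond; apply: ler_sum => k.
  rewrite andbT => /andP[Nk _]; apply: (le_trans (cb k)).
  by apply: ler_wpM2r => //; exact: powR_maxn1_anti (ltW d0) Nk.
rewrite -mulr_sumr mulrC; apply: ler_wpM2r; first exact: powR_ge0.
apply: le_trans (bA n); rewrite -(big_mkord xpredT).
have [nN|Nn] := leqP n N; first by rewrite [leLHS]big_geq//; apply: sumr_ge0.
by rewrite [leRHS](big_cat_nat (n := N))//=; [rewrite lerDr; apply: sumr_ge0|exact: ltnW].
Qed.

Lemma cvg_maxn1_powRN d : 0 < d -> (max1 N) `^ (- d) @[N --> \oo] --> 0.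
Proof.
move=> d0; apply/cvgrPdist_lt => e e0.
near=> N; rewrite sub0r normrN ger0_norm ?powR_ge0//.
have N0 : (0 < N)%N by near: N; exact: nbhs_infty_gt.
rewrite (maxn_idPr N0) powRN invf_plt ?posrE ?powR_gt0 ?ltr0n//.
have -> : e^-1 = (e^-1 `^ d^-1) `^ d.
  by rewrite -powRrM mulVf ?gt_eqF// powRr1// invr_ge0 ltW.
apply: gt0_ltr_powR => //; rewrite ?nnegrE ?powR_ge0 ?ler0n//.
near: N; exact: nbhs_infty_gtr.
Unshelve. all: end_near. Qed.

(** For finite s, each of the at most m nonzero terms is at most 1/m. These are the coefficient
    sequences behind the lower bounds. *)
Lemma seqW_finsupp s mu (J : seq nat) (L m : nat) (c : R) : (1 <= s)%E -> 0 < mu ->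
  (0 < L)%N -> (0 < m)%N -> uniq J -> (size J <= m)%N -> {in J, forall k, (maxn 1 k <= L)%N} ->
  `|c| <= L%:R `^ (- mu) * m%:R `^ (- recip s) ->
  seqW s mu (fun k => if k \in J then c else 0).
Proof.
move=> s1 mu0 L0 m0 uJ Jm JL cL.
have Lp : 0 < L%:R `^ mu :> R by apply: powR_gt0; rewrite ltr0n.
have ck k : k \in J -> (max1 k) `^ mu * `|c| <= m%:R `^ (- recip s).
  move=> /JL kL.
  apply: (@le_trans _ _ (L%:R `^ mu * `|c|)).
    apply: ler_wpM2r => //; apply: ge0_ler_powR; rewrite ?nnegrE ?ler0n ?ler_nat//.
    exact: ltW.
  apply: (@le_trans _ _ (L%:R `^ mu * (L%:R `^ (- mu) * m%:R `^ (- recip s)))).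
    by apply: ler_wpM2l => //; exact: ltW.
  by rewrite mulrA powRN mulfV ?mul1r// gt_eqF.
case: s s1 cL ck => [r||]//.
  rewrite lee_fin => r1 cL ck n; have r0 : 0 < r by exact: lt_le_trans r1.
  apply: (@le_trans _ _ (\sum_(k < n | (k : nat) \in J) (m%:R)^-1)).
    rewrite [leRHS]big_mkcond; apply: ler_sum => k _; case: ifPn => kJ.
      have := ck k kJ; rewrite recip_EFin// => h.
      have -> : m%:R^-1 = (m%:R `^ (- r^-1)) `^ r :> R.
        by rewrite -powRrM mulNr mulVf ?gt_eqF// powR_inv1.
      apply: ge0_ler_powR => //; rewrite ?nnegrE ?mulr_ge0 ?powR_ge0//; exact: ltW.
    by rewrite normr0 mulr0 powR0// gt_eqF.
  rewrite sumr_const -[_ *+ _]mulr_natl ler_pdivrMr ?ltr0n// mul1r ler_nat.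
  apply: leq_trans Jm.
  rewrite cardE -(size_map (@nat_of_ord n)); apply: uniq_leq_size.
    by rewrite map_inj_uniq ?enum_uniq//; exact: ord_inj.
  by move=> x /mapP[i]; rewrite mem_enum => iJ ->.
move=> _ _ ck k; case: ifPn => kJ; last by rewrite normr0 mulr0.
by apply: le_trans (ck k kJ) _; rewrite recipy oppr0 powRr0.
Qed.

Lemma poweR_ler (x y : \bar R) r : (0 <= x)%E -> (x <= y)%E -> 0 <= r -> (x `^ r <= y `^ r)%E.
Proof.
move=> x0 xy r0; apply: gt0_ler_poweR => //; rewrite in_itv/= leey andbT//.
exact: le_trans xy.
Qed.

Lemma smnorm_le1P al s mu f : (1 <= s)%E ->
  (smnorm al s mu f <= 1)%E <-> seqW s mu (coef al f).
Proof.
case: s => [r||]//; last first.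
  move=> _; split=> [h k|h].
    rewrite -lee_fin; apply: le_trans h; apply: ereal_sup_ubound; by exists k.
  by apply: ge_ereal_sup => _ [k _ <-]; rewrite lee_fin; exact: h.
rewrite lee_fin => r1; have r0 : 0 < r by exact: lt_le_trans r1.
rewrite /smnorm /seqW; pose u k : R := ((max1 k) `^ mu * `|coef al f k|) `^ r.
have uE k : (max1 k) `^ (r * mu) * `|coef al f k| `^ r = u k.
  by rewrite /u powRM ?powR_ge0// -powRrM [mu * r]mulrC.
under eq_eseriesr do rewrite uE.
have u0 k : 0 <= u k by exact: powR_ge0.
set X := (\sum_(_ <= _ <oo) _)%E.
have X0 : (0 <= X)%E by apply: nneseries_ge0 => k _ _; rewrite lee_fin.
have X1 : (X `^ r^-1 <= 1)%E <-> (X <= 1)%E.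
  split=> h.
    have := poweR_ler (poweR_ge0 _ _) h (ltW r0).
    by rewrite -poweRrM mulVf ?gt_eqF// poweRe1// poweR1r.
  have rV : 0 <= r^-1 by rewrite invr_ge0 ltW.
  by have := poweR_ler X0 h rV; rewrite poweR1r.
rewrite X1; split=> [h n|h].
  rewrite -lee_fin; apply: le_trans h; rewrite -sumEFin.
  rewrite -(big_mkord xpredT (fun k => (u k)%:E)).
  by apply: nneseries_lim_ge => k _ _; rewrite lee_fin.
apply: lime_le; first by apply: is_cvg_nneseries => k _ _; rewrite lee_fin.
apply: nearW => n; rewrite sumEFin lee_fin big_mkord; exact: h.
Qed.

Lemma counting_gt0 (A : set nat) k : A k -> (0 < (counting A : \bar R))%E.
Proof.
move=> Ak; rewrite /counting; case: asboolP => [fA|_]; last exact: lt0y.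
rewrite lte_fin ltr0n cardfs_gt0; apply/fset0Pn; exists k.
by rewrite in_fset_set// inE.
Qed.

(** All that the recovery estimate uses of the noise, so its rate does not depend on p. For p = oo,
    only the empty set is null for the counting measure, hence the essential supremum bounds every
    entry. *)
Lemma le_lnorm p c (e : R) k : (1 <= p)%E -> (lnorm p c <= e%:E)%E -> `|c k| <= e.
Proof.
case: p => [r||]//.
  rewrite lee_fin => r1; have r0 : 0 < r by exact: lt_le_trans r1.
  rewrite /lnorm Lnorm_counting// => h; rewrite -lee_fin; apply: le_trans h.
  have rV : 0 <= r^-1 by rewrite invr_ge0 ltW.
  apply: (@le_trans _ _ ((`|(c k)%:E| `^ r) `^ r^-1)%E).
    by rewrite -poweRrM mulfV ?gt_eqF// poweRe1.
  apply: poweR_ler => //; first exact: poweR_ge0.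
  apply: le_trans (nneseries_lim_ge k.+1 _); last by move=> i _ _; exact: poweR_ge0.
  by rewrite big_nat_recr//= leeDr// sume_ge0// => i _; exact: poweR_ge0.
move=> _; rewrite /lnorm unlock (counting_gt0 (k := k))// => /ess_supP[A [_ A0 hA]].
rewrite leNgt; apply/negP => ck.
have /hA Ak : (~` [set x | (abse \o (EFin \o c)) x <= e%:E]%E) k.
  by rewrite /= lee_fin; apply/negP; rewrite -ltNge.
by have := counting_gt0 Ak; rewrite A0 ltxx.
Qed.

Lemma lnorm0 p : (1 <= p)%E -> lnorm p (fun=> 0) = 0%E :> \bar R.
Proof.
move=> p1; rewrite /lnorm; apply: Lnorm0.
by rewrite gt_eqF// (lt_le_trans _ p1).
Qed.

End SummableTails.

(** * Uniform convergence of the Laguerre series *)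

Section Expansion.
Context {R : realType}.
Variable al : R.
Hypothesis al0 : 0 <= al.
Implicit Types (t : R) (k m n N : nat) (f g h : R -> R) (p : {poly R}).
Local Notation leb := (@lebesgue_measure R).
Local Notation D := (@halfline R).

Lemma continuous_ell k : continuous (ell al k).
Proof.
move=> t; have [h _] := is_derive_ell al0 k t.
by apply: differentiable_continuous; exact/derivable1_diffP.
Qed.

Lemma continuous_sqrtw t : 0 < t -> {for t, continuous (sqrtw al)}.
Proof.
move=> t0; apply: continuous_comp; first exact: continuous_weight.
exact: sqrt_continuous.
Qed.

Lemma continuous_lagf k t : 0 < t -> {for t, continuous (lagf al k)}.
Proof. by move=> t0; apply: cvgM; [exact: continuous_ell|exact: continuous_sqrtw]. Qed.

Lemma continuous_sum_lagf (c : nat -> R) N t : 0 < t ->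
  {for t, continuous (fun t => \sum_(k < N) c k * lagf al k t)}.
Proof.
move=> t0; elim: N => [|N IH].
  rewrite (_ : (fun _ => _) = fun=> 0); first exact: cst_continuous.
  by apply/funext => u; rewrite big_ord0.
rewrite (_ : (fun _ => _) =
  fun t => \sum_(k < N) c k * lagf al k t + c N * lagf al N t); last first.
  by apply/funext => u; rewrite big_ord_recr.
apply: cvgD; first exact: IH.
by apply: cvgM; [exact: cvg_cst|exact: continuous_lagf].
Qed.

Lemma inC_measurable h : inC h -> measurable_fun D h.
Proof.
move=> hC; apply: open_continuous_measurable_fun; first exact: interval_open.
by move=> t; rewrite inE => /halflineP; exact: hC.
Qed.

Lemma measurable_weight : measurable_fun D (weight al).
Proof. exact: hl_integrable_measurable (hl_integrable_weight al0). Qed.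

Lemma measurable_sqrtw : measurable_fun D (sqrtw al).
Proof. by apply: inC_measurable => t; exact: continuous_sqrtw. Qed.

Lemma hl_integrable_sqrtw_poly c p : 0 <= c -> c < 2^-1 ->
  hl_integrable (fun t => sqrtw al t * expR (c * t) * p.[t]).
Proof.
move=> c0 c2; have al2 : 0 <= al / 2 by rewrite divr_ge0.
have c20 : 0 < 2^-1 - c by rewrite subr_gt0.
apply: eq_hl_integrable (hl_integrable_pow_exp_poly p al2 c20) => t t0.
rewrite sqrtwE// -[_ * expR (- (2^-1 * t)) * expR _]mulrA -expRD; congr (_ * expR _ * _).
ring.
Qed.

(** The product w |f| t^n e^(t/4) is at most w f^2 + w t^(2n) e^(t/2), and the last term still
    decays like e^(-t/2). This is the exponential margin that completeness requires. *)
Lemma L2w_hl_integrable f n : L2w al f ->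
  hl_integrable (fun t => `|weight al t * f t| * t ^+ n * expR (4^-1 * t)).
Proof.
move=> [mf f2].
have i1 : hl_integrable (fun t => weight al t * f t ^+ 2).
  apply/integrableP; split.
    apply/measurable_EFinP; apply: measurable_funM; first exact: measurable_weight.
    exact: measurable_funX.
  move: f2; apply: le_lt_trans; rewrite le_eqVlt; apply/orP; left; apply/eqP.
  apply: eq_integral => t _ /=; rewrite ger0_norm//.
  by rewrite mulr_ge0 ?weight_ge0 ?sqr_ge0.
have c20 : 0 < 2^-1 :> R by rewrite invr_gt0.
have i2 := hl_integrable_pow_exp_poly ('X^n ^+ 2) al0 c20.
apply: hl_integrable_le (hl_integrableD i1 i2).
  apply: measurable_funM.
    apply: measurable_funM; last by [].
    by apply: measurableT_comp => //; apply: measurable_funM => //; exact: measurable_weight.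
  apply: (measurable_funS measurableT) => //; apply: measurableT_comp => //.
  do ?exact: measurable_funM.
move=> t t0; have w0 := weight_ge0 al t.
rewrite ger0_norm ?mulr_ge0 ?expR_ge0 ?exprn_ge0 ?(ltW t0)// normrM (ger0_norm w0).
rewrite /= horner_exp hornerXn.
have -> : t `^ al * expR (- (2^-1 * t)) = weight al t * expR (4^-1 * t) ^+ 2.
  by rewrite /weight -mulrA expr2 -!expRD; congr (_ * expR _); field.
move: (expR (4^-1 * t)) (t ^+ n) => E T.
have -> : f t ^+ 2 = `|f t| ^+ 2 by rewrite real_normK ?num_real.
move: `|f t| => F.
rewrite -subr_ge0 (_ : _ - _ = weight al t * ((F - T * E / 2) ^+ 2 + 3 / 4 * (T * E) ^+ 2)).
  by rewrite mulr_ge0// addr_ge0 ?sqr_ge0// mulr_ge0 ?sqr_ge0.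
by field.
Qed.

Lemma L2w_hl_integrable_poly f p : L2w al f -> hl_integrable (fun t => weight al t * f t * p.[t]).
Proof.
move=> f2; have h : hl_integrable (fun t => \sum_(i < size p)
    p`_i * (weight al t * f t * t ^+ i)).
  apply: hl_integrable_sum => i; apply: hl_integrableZ; apply: hl_integrable_le (L2w_hl_integrable i f2).
    apply: measurable_funM; last by [].
    by apply: measurable_funM; [exact: measurable_weight|exact: f2.1].
  move=> t t0; rewrite normrM normrX (gtr0_norm t0) ler_peMr ?mulr_ge0 ?exprn_ge0 ?(ltW t0)//.
  by rewrite -expR0 ler_expR mulr_ge0 ?(ltW t0).
apply: eq_hl_integrable h => t _; rewrite horner_coef mulr_sumr; apply: eq_bigr => i _; ring.
Qed.

(* The functions lagp k form a triangular basis of the polynomials. *)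
Lemma lagp_span (P : {poly R} -> Prop) : P 0 ->
  (forall p q c, P p -> P q -> P (p + c *: q)) -> (forall k, P (lagp al k)) ->
  forall p, P p.
Proof.
move=> P0 Plin Plag p; have [n] := ubnP (size p); elim: n => // n IH in p *.
rewrite ltnS => pn; case: n IH pn => [|n] IH pn.
  by move: pn; rewrite leqn0 size_poly_eq0 => /eqP ->.
have l0 : (lagp al n)`_n != 0.
  rewrite coef_lagp binn mulr1 mulf_neq0// ?invr_eq0 ?gam_neq0//.
  by rewrite signr_eq0.
pose c := p`_n / (lagp al n)`_n.
rewrite -(subrK (c *: lagp al n) p); apply: (Plin) => //; apply: IH.
rewrite ltnS; apply/leq_sizeP => j; rewrite leq_eqVlt => /predU1P[<-|nj].
  by rewrite coefB coefZ /c divfK// subrr.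
rewrite coefB coefZ coef_lagp bin_small// mulr0 mul0r mulr0 subr0.
by apply: nth_default; exact: leq_trans pn nj.
Qed.

Lemma hl_integrable_lagf_sqr j k : hl_integrable (fun t => lagf al j t * lagf al k t).
Proof.
apply: eq_hl_integrable (hl_integrable_weight_poly al0
    ((lagnorm al j *: lagp al j) * (lagnorm al k *: lagp al k))) => t _.
by rewrite /lagf !ellE// hornerM !hornerZ -sqrtw_sqr; ring.
Qed.

Lemma hl_int_lagf j k : hl_int (fun t => lagf al j t * lagf al k t) = (j == k)%:R.
Proof.
rewrite -(dotw_ell al0) /dotw -hl_intE; apply: eq_hl_int => t _.
by rewrite /lagf -sqrtw_sqr; ring.
Qed.

Lemma hl_integrable_lagf k : hl_integrable (lagf al k).
Proof.
have c2 : 0 < 2^-1 :> R by rewrite invr_gt0.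
apply: eq_hl_integrable (hl_integrable_sqrtw_poly (lagnorm al k *: lagp al k) (lexx 0) c2) => t _.
by rewrite mul0r expR0 mulr1 /lagf ellE// hornerZ mulrC.
Qed.

Section WeightedClass.
Variables (s : \bar R) (mu : R).
Hypotheses (s1 : (1 <= s)%E) (mu0 : 0 < mu) (smu : 1 - recip s < mu).

(** The rate follows from the tails of the coefficients; the work lies in showing that the limit
    represents f. The bound [B] is exported as well, since perturbations of the coefficients are
    summed against the same functions. *)
Theorem laguerre_expansion : exists d A B, [/\ 0 < d, 0 < A, 0 < B,
  (forall k t, 0 < t -> `|lagf al k t| <= B) &
  forall f, W al s mu f -> exists h, Crepr (f \* sqrtw al) h /\
    forall N t, 0 < t ->
      `|h t - \sum_(k < N) coef al f k * lagf al k t| <= A * (maxn 1 N)%:R `^ (- d)].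
Proof.
have [d [A [d0 A0 hA]]] := seqW_tail s1 mu0 smu.
have [B B0 hB] := lagf_bounded al0.
exists d, (A * B), B; split=> //; first exact: mulr_gt0.
move=> f [f2 /(smnorm_le1P al mu f s1)/hA tail]; pose c := coef al f.
pose S n t := \sum_(k < n) c k * lagf al k t.
have SN N n t : 0 < t -> (N <= n)%N ->
    `|S n t - S N t| <= A * B * (maxn 1 N)%:R `^ (- d).
  move=> t0 Nn.
  rewrite /S -!(big_mkord xpredT (fun k => c k * lagf al k t)).
  rewrite [X in X - _](big_cat_nat (n := N))//= [X in X - _]addrC addrK.
  apply: le_trans (ler_norm_sum _ _ _) _.
  apply: (@le_trans _ _ (\sum_(N <= k < n) `|c k| * B)).
    by apply: ler_sum => k _; rewrite normrM ler_wpM2l// hB.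
  by rewrite -mulr_suml mulrAC ler_wpM2r ?(ltW B0).
have rate0 : (maxn 1 N)%:R `^ (- d) @[N --> \oo] --> (0 : R) := cvg_maxn1_powRN d0.
have AB0 : 0 < A * B by exact: mulr_gt0.
have ratee (e : R) : 0 < e -> exists N, A * B * (maxn 1 N)%:R `^ (- d) < e.
  move=> e0; have eAB : 0 < e / (A * B) by exact: divr_gt0.
  have [N _ /(_ N (leqnn _)) h] := cvgr_lt _ rate0 _ eAB.
  by exists N; rewrite mulrC -ltr_pdivlMr.
have cvgS t : 0 < t -> cvgn (S ^~ t).
  move=> t0; pose u k := c k * lagf al k t.
  have -> : S ^~ t = series u by apply/funext => n; rewrite /S /series/= big_mkord.
  apply: normed_cvg; apply: nondecreasing_is_cvgn.
    by apply: nondecreasing_series => i _ _; exact: normr_ge0.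
  exists (A * (maxn 1 0)%:R `^ (- d) * B) => _ [n _ <-].
  apply: (@le_trans _ _ (\sum_(0 <= k < n) `|c k| * B)).
    by rewrite /=; apply: ler_sum => k _; rewrite /u normrM ler_wpM2l// hB.
  by rewrite -mulr_suml ler_wpM2r ?(ltW B0).
pose h t := limn (S ^~ t).
have hS N t : 0 < t -> `|h t - S N t| <= A * B * (maxn 1 N)%:R `^ (- d).
  move=> t0; apply/ler_addgt0Pr => e e0.
  have := cvgS t t0 => /cvgrPdist_lt/(_ e e0)[n _ hn].
  have := hn (maxn n N) (leq_maxl _ _); rewrite /= -/(h t) => h1.
  have h2 := SN N (maxn n N) t t0 (leq_maxr _ _).
  rewrite -[h t - _](subrKA (S (maxn n N) t)).
  by apply: le_trans (ler_normD _ _) _; rewrite addrC; apply: lerD => //; exact: ltW.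
have hC : inC h.
  move=> t t0; apply/cvgrPdist_lt => e e0.
  have e3 : 0 < e / 3 by rewrite divr_gt0.
  have [N hN] := ratee _ e3.
  have cS : {for t, continuous (S N)} by exact: continuous_sum_lagf.
  have /cvgrPdist_lt/(_ _ e3) near1 := cS.
  near=> u; have u0 : 0 < u by near: u; exact: lt_nbhsr.
  have h1 := le_lt_trans (hS N t t0) hN.
  have h2 := le_lt_trans (hS N u u0) hN.
  have h3 : `|S N t - S N u| < e / 3 by near: u.
  rewrite distrC in h2.
  have -> : h t - h u = (h t - S N t) + (S N t - S N u) + (S N u - h u) by ring.
  apply: le_lt_trans (ler_normD _ _) _.
  have := ler_normD (h t - S N t) (S N t - S N u); lra.
exists h; split; last by exact: hS.
split=> //.
have mh := inC_measurable hC.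
have hb t : 0 < t -> `|h t| <= A * B.
  move=> t0; have := hS 0%N t t0.
  by rewrite /S big_ord0 subr0 (_ : maxn 1 0 = 1%N)// powR1 mulr1.
(* [h] is only known to be bounded, so the decay has to come from sqrt w alone, hence q < 1/2. *)
have hl_integrable_hpoly q p : 0 <= q -> q < 2^-1 ->
    hl_integrable (fun t => sqrtw al t * expR (q * t) * h t * p.[t]).
  move=> q0 q2; have i := hl_integrableZ (A * B) (hl_integrable_norm (hl_integrable_sqrtw_poly p q0 q2)).
  apply: hl_integrable_le i.
    apply: measurable_funM.
      apply: measurable_funM => //; apply: measurable_funM; first exact: measurable_sqrtw.
      apply: (measurable_funS measurableT) => //; apply: measurableT_comp => //.
      do ?exact: measurable_funM.
    apply: (measurable_funS measurableT) => //; exact: measurable_poly.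
  move=> t t0; rewrite mulrAC normrM [leRHS]mulrC; apply: ler_wpM2l => //.
  exact: hb.
have i02 : 0 < 2^-1 :> R by rewrite invr_gt0.
(* This is sqrt w times (f sqrt w - h), so it vanishes almost everywhere exactly when [h] represents
   f. *)
pose phi t := weight al t * f t - sqrtw al t * h t.
have moments p : hl_int (fun t => phi t * p.[t]) = 0.
  have ip q : hl_integrable (fun t => phi t * q.[t]).
    apply: eq_hl_integrable (hl_integrableB (L2w_hl_integrable_poly q f2)
      (hl_integrable_hpoly 0 q (lexx 0) i02)) => t _.
    by rewrite /phi /= mul0r expR0 mulr1 mulrBl.
  move: p; apply: lagp_span.
  - by rewrite -[RHS](@hl_int0 R); apply: eq_hl_int => t _; rewrite horner0 mulr0.
  - move=> p q a p0 q0; rewrite -[RHS]addr0 -[X in _ = X + _]p0 -[X in _ = _ + X](mulr0 a).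
    rewrite -[X in _ = _ + _ * X]q0 -hl_intZ// -hl_intD//; last exact: hl_integrableZ.
    by apply: eq_hl_int => t _; rewrite hornerD hornerZ; ring.
  - move=> j.
    have ihl : hl_integrable (fun t => h t * lagf al j t).
      apply: eq_hl_integrable (hl_integrable_hpoly 0 (lagnorm al j *: lagp al j) (lexx 0) i02) => t _.
      by rewrite mul0r expR0 mulr1 /lagf ellE// hornerZ; ring.
    (* The uniform error of the partial sums is integrated against [lagf j], which is in L_1. *)
    have hj : hl_int (fun t => h t * lagf al j t) = c j.
      apply/eqP; rewrite -subr_eq0 -normr_le0; apply/ler_addgt0Pr => e e0; rewrite add0r.
      pose Kj := hl_int (fun t => `|lagf al j t|) + 1.
      have Kj1 : 0 <= hl_int (fun t => `|lagf al j t|) by apply: hl_int_ge0.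
      have Kj0 : 0 < Kj by rewrite ltr_wpDl.
      have eK : 0 < e / Kj by exact: divr_gt0.
      (* At least [j.+1] terms are kept, so that the index j occurs in the partial sum. *)
      have [N0 hN0] := ratee _ eK; pose N := maxn N0 j.+1.
      have iS : hl_integrable (fun t => S N t * lagf al j t).
        have : hl_integrable (fun t => \sum_(k < N) c k * (lagf al k t * lagf al j t)).
          by apply: hl_integrable_sum => k; apply: hl_integrableZ; exact: hl_integrable_lagf_sqr.
        by apply: eq_hl_integrable => t _; rewrite /S mulr_suml; apply: eq_bigr => k _; rewrite mulrA.
      have SNj : hl_int (fun t => S N t * lagf al j t) = c j.
        transitivity (hl_int (fun t => \sum_(k < N) c k * (lagf al k t * lagf al j t))).
          by apply: eq_hl_int => t _; rewrite /S mulr_suml; apply: eq_bigr => k _; rewrite mulrA.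
        rewrite hl_int_sum; last by move=> k; apply: hl_integrableZ; exact: hl_integrable_lagf_sqr.
        have jN : (j < N)%N by rewrite leq_max leqnn orbT.
        rewrite (bigD1 (Ordinal jN))//= hl_intZ ?hl_int_lagf ?eqxx ?mulr1; last exact: hl_integrable_lagf_sqr.
        rewrite big1 ?addr0// => k kj; rewrite hl_intZ ?hl_int_lagf; last exact: hl_integrable_lagf_sqr.
        rewrite (_ : _ == _ = false) ?mulr0//; apply/negbTE.
        by apply: contra kj => /eqP kj; apply/eqP/val_inj.
      rewrite -SNj -hl_intB//.
      apply: (le_trans (hl_int_norm (hl_integrableB ihl iS))).
      apply: (@le_trans _ _ (hl_int (fun t => (e / Kj) * `|lagf al j t|))).
        apply: hl_int_le; [exact/hl_integrable_norm/hl_integrableB|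
          exact/hl_integrableZ/hl_integrable_norm/hl_integrable_lagf|].
        move=> t t0; rewrite /= -mulrBl normrM; apply: ler_wpM2r => //.
        apply: (le_trans (hS N t t0)); apply: le_trans (ltW hN0).
        apply: ler_wpM2l; first exact: ltW.
        by apply: powR_maxn1_anti; [exact: ltW|exact: leq_maxl].
      rewrite hl_intZ; last exact/hl_integrable_norm/hl_integrable_lagf.
      by rewrite mulrAC ler_pdivrMr// ler_wpM2l ?(ltW e0)// lerDl.
    apply: (mulfI (lt0r_neq0 (lagnorm_gt0 al0 j))); rewrite mulr0 -hl_intZ//.
    transitivity (hl_int (fun t => weight al t * f t * ell al j t - h t * lagf al j t)).
      by apply: eq_hl_int => t _; rewrite /phi /lagf ellE//; ring.
    rewrite hl_intB//; last first.
      apply: eq_hl_integrable (L2w_hl_integrable_poly (lagnorm al j *: lagp al j) f2) => t _.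
      by rewrite ellE// hornerZ.
    by rewrite hj hl_intE -/(dotw _ _ _) -/(coef _ _ _) subrr.
have hphi n : hl_integrable (fun t => `|phi t| * t ^+ n * expR (4^-1 * t)).
  have q0 : 0 <= 4^-1 :> R by rewrite invr_ge0.
  have q2 : 4^-1 < 2^-1 :> R by lra.
  have i := hl_integrableD (L2w_hl_integrable n f2)
    (hl_integrable_norm (hl_integrable_hpoly 4^-1 'X^n q0 q2)).
  apply: hl_integrable_le i.
    apply: measurable_funM.
      apply: measurable_funM; last by [].
      apply: measurableT_comp => //; apply: measurable_funB.
        by apply: measurable_funM; [exact: measurable_weight|exact: f2.1].
      by apply: measurable_funM; [exact: measurable_sqrtw|].
    apply: (measurable_funS measurableT) => //; apply: measurableT_comp => //.
    do ?exact: measurable_funM.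
  move=> t t0; rewrite ger0_norm ?mulr_ge0 ?expR_ge0 ?exprn_ge0 ?(ltW t0)//=.
  rewrite hornerXn [X in _ + `|X|](_ : _ = sqrtw al t * h t * (t ^+ n * expR (4^-1 * t))); last by ring.
  have E0 : 0 <= t ^+ n * expR (4^-1 * t) by rewrite mulr_ge0 ?expR_ge0 ?exprn_ge0 ?(ltW t0).
  rewrite (normrM (sqrtw al t * h t)) (ger0_norm E0).
  rewrite -(mulrA `|phi t|) -(mulrA `|weight al t * f t|) -mulrDl.
  apply: ler_wpM2r => //.
  by rewrite /phi; exact: ler_normB.
have mphi : measurable_fun D phi.
  apply: measurable_funB.
    by apply: measurable_funM; [exact: measurable_weight|exact: f2.1].
  by apply: measurable_funM; [exact: measurable_sqrtw|].
have phi0 n : hl_int (fun t => phi t * t ^+ n) = 0.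
  by rewrite -[RHS](moments 'X^n); apply: eq_hl_int => t _; rewrite hornerXn.
have := ae_eq0_of_moments mphi hphi phi0.
apply: filterS; first exact: (ae_filter_ringOfSetsType leb).
move=> t phit t0; apply: (mulfI (lt0r_neq0 (sqrtw_gt0 al t0))).
by have := phit t0; rewrite /phi -sqrtw_sqr /= => /eqP; rewrite subr_eq0 => /eqP <-; ring.
Unshelve. all: end_near. Qed.

End WeightedClass.

End Expansion.

(** * The weighted norm through continuous representatives *)

Section ContinuousRepresentative.
Context {R : realType}.
Implicit Types (al t : R) (f g h : R -> R) (v : \bar R).
Local Notation leb := (@lebesgue_measure R).

(** A point of disagreement has a whole ball of disagreement around it, of positive measure. This
    makes the norm independent of the representative chosen in [normCext]. *)
Lemma inC_ae_eq h1 h2 : inC h1 -> inC h2 ->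
  {ae leb, forall t, 0 < t -> h1 t = h2 t} -> forall t, 0 < t -> h1 t = h2 t.
Proof.
move=> c1 c2 [N [mN N0 hN]] t t0; apply/eqP; rewrite -subr_eq0; apply/negP => /negP d0.
have cd : {for t, continuous (fun u => h1 u - h2 u)}.
  by apply: cvgB; [exact: c1|exact: c2].
have dpos : 0 < `|h1 t - h2 t| by rewrite normr_gt0.
have nd : \forall u \near t, 0 < u /\ h1 u != h2 u.
  near=> u; split; first by near: u; exact: lt_nbhsr.
  rewrite -subr_eq0; apply/negP => /eqP u0.
  suff : `|h1 t - h2 t - (h1 u - h2 u)| < `|h1 t - h2 t| by rewrite u0 subr0 ltxx.
  by near: u; move/cvgrPdist_lt : cd => /(_ _ dpos).
have [e /= e0 he] := nd.
have : (leb (ball t e) <= leb N)%E.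
  apply: le_measure; rewrite ?inE; [exact: measurable_ball|exact: mN|].
  by move=> u /he[u0 hu]; apply: hN => /(_ u0) /eqP; apply/negP.
rewrite N0 lebesgue_measure_ball ?(ltW e0)// lee_fin leNgt => /negP; apply.
by rewrite mulrn_wgt0.
Unshelve. all: end_near. Qed.

Lemma le_normC h t : 0 < t -> (`|h t|%:E <= normC h)%E.
Proof. by move=> t0; apply: ereal_sup_ubound; exists t => //; exact/halflineP. Qed.

Lemma normC_le h (x : \bar R) : (forall t, 0 < t -> (`|h t|%:E <= x)%E) -> (normC h <= x)%E.
Proof. by move=> hx; apply: ge_ereal_sup => _ [t /halflineP t0 <-]; exact: hx. Qed.

Lemma normC_eq h1 h2 : (forall t, 0 < t -> h1 t = h2 t) -> normC h1 = normC h2.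
Proof.
move=> h12; apply/eqP; rewrite eq_le; apply/andP; split.
  by apply: normC_le => t t0; rewrite h12//; exact: le_normC.
by apply: normC_le => t t0; rewrite -h12//; exact: le_normC.
Qed.

Lemma wnorm_Crepr al v g h : Crepr (g \* sqrtw al) h -> wnorm al v g = normC h.
Proof.
move=> [ch gh]; rewrite /wnorm /normCext; case: pselect => [e|]; last first.
  by case; exists h.
case: (cid e) => h' /= [ch' gh']; apply: normC_eq; apply: inC_ae_eq => //.
move: gh gh'; apply: filterS2; first exact: (ae_filter_ringOfSetsType leb).
by move=> t e1 e2 t0; rewrite -e1// -e2.
Qed.

Lemma wnorm_inC al v g : inC g -> wnorm al v g = normC (g \* sqrtw al).
Proof.
move=> cg; apply: wnorm_Crepr; split; last by apply: aeW.
by move=> t t0; apply: cvgM; [exact: cg|exact: continuous_sqrtw].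
Qed.

End ContinuousRepresentative.

(** * Block polynomials and lower bounds *)

Section Blocks.
Context {R : realType}.
Variable al : R.
Hypothesis al0 : 0 <= al.
Implicit Types (t c : R) (J : seq nat) (k m n N M : nat) (s v : \bar R) (mu : R).
Local Notation leb := (@lebesgue_measure R).

(** The common test function: [f1] is such a block, and the recovery bound takes one with
    frequencies outside Omega. The amplitude is signed so that the opposite function is again a
    block. *)
Definition block J c t : R := c * \sum_(k <- J) ell al k t.

Lemma blockE J c : block J c = horner (c *: \sum_(k <- J) (lagnorm al k *: lagp al k)).
Proof.
apply/funext => t; rewrite /block hornerZ horner_sum; congr (_ * _).
by apply: eq_bigr => k _; rewrite ellE// hornerZ.
Qed.

Lemma blockN J c t : block J (- c) t = - block J c t.
Proof. by rewrite /block mulNr. Qed.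

Lemma inC_block J c : inC (block J c).
Proof. by rewrite blockE => t _; exact: continuous_horner. Qed.

Lemma L2w_poly (p : {poly R}) : L2w al (horner p).
Proof.
split.
  apply: measurable_funTS; apply: continuous_measurable_fun.
  exact: continuous_horner.
have h : hl_integrable (fun t => weight al t * p.[t] ^+ 2).
  by apply: eq_hl_integrable (hl_integrable_weight_poly al0 (p ^+ 2)) => t _; rewrite horner_exp.
by apply: integrable_lty h; exact: measurable_itv.
Qed.

Lemma coef_block J c k : uniq J -> coef al (block J c) k = if k \in J then c else 0.
Proof.
move=> uJ; have hjk j : hl_integrable (fun t => weight al t * ell al j t * ell al k t).
  apply: eq_hl_integrable (hl_integrable_weight_poly al0
    ((lagnorm al j *: lagp al j) * (lagnorm al k *: lagp al k))) => t _.
  by rewrite hornerM !hornerZ !ellE//; ring.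
rewrite /coef /dotw -hl_intE.
transitivity (hl_int (fun t => \sum_(j <- J) c * (weight al t * ell al j t * ell al k t))).
  apply: eq_hl_int => t _; rewrite /block -mulr_sumr -mulr_suml -mulr_sumr; ring.
rewrite hl_int_sum; last by move=> j; exact: hl_integrableZ.
have e j : hl_int (fun t => c * (weight al t * ell al j t * ell al k t)) = c * (j == k)%:R.
  by rewrite hl_intZ// hl_intE -/(dotw _ _ _) dotw_ell.
under eq_bigr do rewrite e.
case: ifPn => kJ.
  rewrite (bigD1_seq k)//= eqxx mulr1 big1 ?addr0// => j jk.
  by rewrite (negbTE jk) mulr0.
rewrite big_seq big1// => j jJ; rewrite (_ : _ == _ = false) ?mulr0//.
by apply/negbTE; apply: contraNneq kJ => <-.
Qed.

Lemma block_W J c s mu (L m : nat) : (1 <= s)%E -> 0 < mu ->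
  (0 < L)%N -> (0 < m)%N -> uniq J -> (size J <= m)%N ->
  {in J, forall k, (maxn 1 k <= L)%N} ->
  `|c| <= L%:R `^ (- mu) * m%:R `^ (- recip s) -> W al s mu (block J c).
Proof.
move=> s1 mu0 L0 m0 uJ Jm JL cL; split; first by rewrite blockE; exact: L2w_poly.
apply/(smnorm_le1P al mu _ s1).
rewrite (_ : coef al (block J c) = fun k => if k \in J then c else 0).
  exact: (seqW_finsupp s1 mu0 L0 m0 uJ Jm JL cL).
by apply/funext => k; exact: coef_block.
Qed.

(** [th] is the lower end of the range of k t over the block: 1/12 for [f1], 1/18 for recovery. *)
Lemma block_lower J c t (th : R) m : 0 <= c -> 0 < t -> t <= 12^-1 -> 0 <= th ->
  (m <= size J)%N ->
  {in J, forall k, (0 < k)%N /\ th <= k%:R * t <= 6^-1} ->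
  c * m%:R * (th `^ (al / 2) * (7039 / 10000 / gam al 0)) <= block J c t * sqrtw al t.
Proof.
move=> c0 t0 t12 th0 mJ hJ.
have G0 : 0 <= 7039 / 10000 / gam al 0.
  by apply: divr_ge0; [lra|exact/ltW/gam_gt0].
have lf k : (0 < k)%N -> k%:R * t <= 6^-1 ->
    (k%:R * t) `^ (al / 2) * (7039 / 10000 / gam al 0) <= lagf al k t.
  by move=> k0 kt; exact: lagf_lower.
move: (7039 / 10000 / gam al 0) G0 lf => G G0 lf.
rewrite /block -(mulrA c) -(mulrA c); apply: ler_wpM2l => //.
rewrite mulr_suml; set E := _ `^ _ * _.
have E0 : 0 <= E by rewrite /E mulr_ge0 ?powR_ge0.
apply: (@le_trans _ _ (\sum_(k <- J) E)).
  rewrite big_const_seq count_predT iter_addr_0 -[E *+ _]mulr_natl.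
  by apply: ler_wpM2r => //; rewrite ler_nat.
rewrite big_seq [leRHS]big_seq; apply: ler_sum => k /hJ[k0 /andP[h1 h2]].
apply: le_trans (lf k k0 h2); apply: ler_wpM2r => //.
by apply: ge0_ler_powR; rewrite ?nnegrE ?divr_ge0// (le_trans th0 h1).
Qed.

Lemma f1E s mu M : f1 al s mu M =
  block (index_iota M M.*2) (2 `^ (- mu) * M%:R `^ (- mu - recip s)).
Proof. by apply/funext => t. Qed.

(** All frequencies of [f1] exceed N, so the partial sum annihilates it, while (2M)^(-mu) M^(-1/s)
    is the amplitude that [block_W] allows for M frequencies below 2M. *)
Lemma eps_ge_f1 s mu v N M : (1 <= s)%E -> 0 < mu -> (0 < N)%N -> (N < M)%N ->
  (normC (f1 al s mu M \* sqrtw al)%R <= eps al v s mu N)%E.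
Proof.
move=> s1 mu0 N0 NM; have M0 : (0 < M)%N by exact: ltn_trans NM.
set c := 2 `^ (- mu) * M%:R `^ (- mu - recip s).
have c0 : 0 <= c by rewrite mulr_ge0 ?powR_ge0.
have fW : W al s mu (f1 al s mu M).
  rewrite f1E; apply: (@block_W _ _ _ _ M.*2 M) => //.
  - by rewrite double_gt0.
  - exact: iota_uniq.
  - by rewrite size_iota -addnn addnK.
  - move=> k; rewrite mem_index_iota => /andP[Mk kM].
    by rewrite geq_max (ltnW kM) andbT double_gt0.
  - rewrite (ger0_norm c0) -mul2n natrM powRM//.
    by rewrite -mulrA -powRD ?pnatr_eq0 -?lt0n ?M0 ?implybT.
apply: le_trans (ereal_sup_ubound _); last by exists (f1 al s mu M).
have S0 : fourier_sum al N (f1 al s mu M) = fun=> 0.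
  apply/funext => t; rewrite /fourier_sum big1// => k _.
  rewrite f1E coef_block ?iota_uniq// mem_index_iota.
  by rewrite leqNgt (leq_ltn_trans (leq_ord k) NM) mul0r.
rewrite S0 (_ : _ \- _ = f1 al s mu M); last by apply/funext => t /=; rewrite subr0.
by rewrite f1E wnorm_inC//; exact: inC_block.
Qed.

Lemma f1_lower s mu M : (0 < M)%N ->
  ((2 `^ (- mu) * cbar al * M%:R `^ (- mu - recip s + 1))%:E
     <= normC (f1 al s mu M \* sqrtw al)%R)%E.
Proof.
move=> M0; have Mp : 0 < M%:R :> R by rewrite ltr0n.
have M1 : 1 <= M%:R :> R by rewrite ler1n.
(* For M <= k < 2M this puts k t into [1/12, 1/6]: the upper end is the limit of [lagf_lower], the
   lower end produces the power of 12 in [cbar]. *)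
pose t : R := (12 * M%:R)^-1.
have t0 : 0 < t by rewrite invr_gt0 mulr_gt0.
apply: le_trans (le_normC _ t0); rewrite lee_fin /=.
apply: le_trans (ler_norm _); rewrite f1E.
set c := 2 `^ (- mu) * M%:R `^ (- mu - recip s).
have c0 : 0 <= c by rewrite mulr_ge0 ?powR_ge0.
have -> : 2 `^ (- mu) * cbar al * M%:R `^ (- mu - recip s + 1) =
    c * M%:R * (12^-1 `^ (al / 2) * (7039 / 10000 / gam al 0)).
  rewrite powRD ?(gt_eqF Mp) ?implybT// (powRr1 (ltW Mp)) /cbar /c.
  rewrite -[12^-1]powR_inv1// -powRrM mulN1r GammaE /gam add0r.
  by ring.
apply: block_lower => //.
- by rewrite /t lef_pV2 ?posrE ?mulr_gt0//; lra.
- by rewrite size_iota -addnn addnK.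
move=> k; rewrite mem_index_iota => /andP[Mk kM].
split; first exact: leq_trans M0 Mk.
have h1 : M%:R <= k%:R :> R by rewrite ler_nat.
have h2 : k%:R <= 2 * M%:R :> R by rewrite -natrM ler_nat mul2n ltnW.
have -> : 12^-1 = M%:R * t by rewrite /t; field; rewrite gt_eqF.
have -> : 6^-1 = 2 * M%:R * t by rewrite /t; field; rewrite gt_eqF.
by rewrite !ler_pM2r// h1.
Qed.

Lemma powR_unbounded (e c A : R) N : 0 < e -> 0 < c ->
  exists2 M : nat, (N < M)%N & A <= c * M%:R `^ e.
Proof.
move=> e0 c0; pose x := (`|A| / c) `^ e^-1.
exists (maxn N (Num.truncn x)).+1; first by rewrite ltnS leq_maxl.
have xM : x <= (maxn N (Num.truncn x)).+1%:R.
  apply: (@le_trans _ _ (Num.truncn x).+1%:R); first by rewrite ltW// truncnS_gt.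
  by rewrite ler_nat ltnS leq_maxr.
have -> : A = A / c * c by rewrite divfK// gt_eqF.
rewrite mulrC ler_pM2l//; apply: (@le_trans _ _ (`|A| / c)).
  by rewrite ler_pM2r ?invr_gt0// ler_norm.
have -> : `|A| / c = x `^ e.
  by rewrite /x -powRrM mulVf ?gt_eqF// powRr1// divr_ge0// ltW.
by apply: ge0_ler_powR; rewrite ?nnegrE ?powR_ge0// ltW.
Qed.

Lemma cbar_gt0 : 0 < cbar al.
Proof.
rewrite /cbar GammaE; apply: mulr_gt0; last exact: powR_gt0.
by apply: divr_gt0; [lra|exact: hl_int_weight_gt0].
Qed.

(** Frequencies up to 3M replace those up to 2M: hence the factor 3^(-mu), and the point t =
    1/(18M), for which k t lies in [1/18, 1/6]. *)
Definition recovery_cst mu : R := 3 `^ (- mu) * (18^-1 `^ (al / 2) * (7039 / 10000 / gam al 0)).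

Lemma recovery_cst_gt0 mu : 0 < recovery_cst mu.
Proof.
apply: mulr_gt0; first exact: powR_gt0.
apply: mulr_gt0; first by apply: powR_gt0; rewrite invr_gt0.
by apply: divr_gt0; [lra|exact: gam_gt0].
Qed.

(* Since Omega misses at least M of the 2M indices in [M, 3M), the information
   does not separate a block function from its opposite. *)
Lemma Rmin_lower s mu v p N M (delta : R) : (1 <= s)%E -> (1 <= p)%E -> 0 < mu ->
  (0 < N)%N -> (N <= M)%N -> 0 < delta ->
  ((recovery_cst mu * M%:R `^ (- mu - recip s + 1))%:E <= Rmin al v s mu p N delta)%E.
Proof.
move=> s1 p1 mu0 N0 NM d0; have M0 : (0 < M)%N by exact: leq_trans NM.
have Mp : 0 < M%:R :> R by rewrite ltr0n.
apply: le_ereal_inf_tmp => _ [psi [Om [rpsi OmN ->]]].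
pose J0 := [seq k <- index_iota M (3 * M) | k \notin Om].
have uJ0 : uniq J0 by rewrite filter_uniq// iota_uniq.
have sJ0 : (M <= size J0)%N.
  have h : (size [seq k <- index_iota M (3 * M) | k \in Om] <= N)%N.
    apply: leq_trans OmN; apply: uniq_leq_size.
      by rewrite filter_uniq// iota_uniq.
    by move=> k; rewrite mem_filter => /andP[].
  have : (size J0 + size [seq k <- index_iota M (3 * M) | k \in Om] = 2 * M)%N.
    rewrite addnC !size_filter (count_predC (mem Om)) size_iota; lia.
  lia.
(* Exactly M indices: no more, for the amplitude M^(-1/s) to be admissible, and no fewer, for the
   lower bound. *)
pose J := take M J0.
have uJ : uniq J by exact: take_uniq.
have sJ : size J = M by rewrite size_takel.
have hJ k : k \in J -> [/\ k \notin Om, (M <= k)%N & (k < 3 * M)%N].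
  by move=> /mem_take; rewrite mem_filter mem_index_iota => /andP[-> /andP[-> ->]].
pose c := 3 `^ (- mu) * M%:R `^ (- mu - recip s).
have c0 : 0 <= c by rewrite mulr_ge0 ?powR_ge0.
have fW e : `|e| = c -> W al s mu (block J e).
  move=> ec; apply: (@block_W _ _ _ _ (3 * M) M) => //.
  - by rewrite muln_gt0.
  - by rewrite sJ.
  - move=> k /hJ[_ Mk kM].
    by rewrite geq_max (ltnW kM) andbT muln_gt0.
  - rewrite ec natrM powRM//.
    by rewrite -mulrA -powRD ?pnatr_eq0 -?lt0n ?M0 ?implybT.
have info e : Ginfo al Om (block J e) = fun=> 0.
  apply/funext => k; rewrite /Ginfo; case: ifPn => // kOm.
  by rewrite coef_block//; case: ifPn => // /hJ[]; rewrite kOm.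
pose h0 := psi (fun=> 0).
have h0C : inC h0.
  apply: rpsi; rewrite /ell2 /= lnorm0; first exact: lt0y.
  by rewrite lee_fin ler1n.
have le_err e : `|e| = c ->
    (normC ((block J e \- h0) \* sqrtw al)%R <= err al v s mu p delta psi Om)%E.
  move=> ec; apply: le_trans (ereal_sup_ubound _); last first.
    by exists (block J e); [exact: fW|reflexivity].
  apply: le_trans (ereal_sup_ubound _); last first.
    (* Exact data are admissible at every noise level. *)
    exists (block J e); last reflexivity.
    split; first by rewrite blockE; exact: L2w_poly.
    rewrite (_ : (fun k => _) = fun=> 0); first by rewrite lnorm0// lee_fin ltW.
    by apply/funext => k; rewrite subrr.
  rewrite info wnorm_inC// => t t0.
  by apply: cvgB; [exact: inC_block|exact: h0C].
pose t : R := (18 * M%:R)^-1.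
have t0 : 0 < t by rewrite invr_gt0 mulr_gt0.
have M1 : 1 <= M%:R :> R by rewrite ler1n.
have blk : c * M%:R * (18^-1 `^ (al / 2) * (7039 / 10000 / gam al 0)) <=
    block J c t * sqrtw al t.
  apply: block_lower => //.
  - by rewrite /t lef_pV2 ?posrE ?mulr_gt0//; lra.
  - by rewrite sJ.
  move=> k /hJ[_ Mk kM]; split; first exact: leq_trans M0 Mk.
  have h1 : M%:R <= k%:R :> R by rewrite ler_nat.
  have h2 : k%:R <= 3 * M%:R :> R by rewrite -natrM ler_nat ltnW.
  have -> : 18^-1 = M%:R * t by rewrite /t; field; rewrite gt_eqF.
  have -> : 6^-1 = 3 * M%:R * t by rewrite /t; field; rewrite gt_eqF.
  by rewrite !ler_pM2r// h1.
have -> : recovery_cst mu * M%:R `^ (- mu - recip s + 1) =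
    c * M%:R * (18^-1 `^ (al / 2) * (7039 / 10000 / gam al 0)).
  by rewrite powRD ?(gt_eqF Mp) ?implybT// (powRr1 (ltW Mp)) /recovery_cst /c; ring.
have cp : `|c| = c by rewrite ger0_norm.
have cm : `|- c| = c by rewrite normrN.
have e1 := le_trans (le_normC _ t0) (le_err c cp).
have e2 := le_trans (le_normC _ t0) (le_err (- c) cm).
(* Whatever the sign of the common answer [h0] at t, the block of the opposite sign misses it there
   by at least its own height. *)
have [hpos|hneg] := leP 0 (h0 t * sqrtw al t).
  apply: le_trans e2; rewrite lee_fin; apply: (le_trans blk).
  rewrite -normrN; apply: le_trans (ler_norm _).
  by rewrite /= blockN; lra.
apply: le_trans e1; rewrite lee_fin; apply: (le_trans blk).
by apply: le_trans (ler_norm _); rewrite /=; lra.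
Qed.

Lemma Rmin_ge0 s mu v p N (delta : R) : (1 <= s)%E -> (1 <= p)%E -> 0 < mu ->
  (0 < N)%N -> 0 < delta -> (0 <= Rmin al v s mu p N delta)%E.
Proof.
move=> s1 p1 mu0 N0 d0; apply: le_trans (Rmin_lower _ s1 p1 mu0 N0 (leqnn N) d0).
by rewrite lee_fin mulr_ge0 ?powR_ge0// ltW// recovery_cst_gt0.
Qed.

End Blocks.

(** * Upper bounds above the threshold *)

Section UpperBounds.
Context {R : realType}.
Variable al : R.
Hypothesis al0 : 0 <= al.
Variables (s p : \bar R) (mu : R).
Hypotheses (s1 : (1 <= s)%E) (p1 : (1 <= p)%E) (mu0 : 0 < mu) (smu : 1 - recip s < mu).
Implicit Types (t : R) (k n N : nat) (v : \bar R).

(** One estimate, [approx], for partial sums with coefficients off by at most e serves both bounds: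
    e = 0 for the Fourier method, e = delta for recovery from the first N noisy coefficients. *)
Lemma recovery_bounds : exists d A B, [/\ 0 < d, 0 < A, 0 < B,
  forall v N, (eps al v s mu N <= (A * N.+1%:R `^ (- d))%:E)%E &
  forall v N (delta : R), (0 < N)%N -> 0 < delta ->
    (Rmin al v s mu p N delta <= (A * N%:R `^ (- d) + B * N%:R * delta)%:E)%E].
Proof.
have [d [A [B [d0 A0 B0 hB hf]]]] := laguerre_expansion al0 s1 mu0 smu.
have approx v N f (a : nat -> R) e : W al s mu f -> (0 < N)%N ->
    (forall k, (k < N)%N -> `|a k - coef al f k| <= e) ->
    (wnorm al v (f \- (fun t => \sum_(k < N) a k * ell al k t))%R <=
      (A * N%:R `^ (- d) + B * N%:R * e)%:E)%E.
  move=> /hf[h [[ch fh] hS]] N0 ae.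
  rewrite (@wnorm_Crepr _ _ _ _ (fun t => h t - \sum_(k < N) a k * lagf al k t)).
    apply: normC_le => t t0; rewrite lee_fin.
    rewrite -[X in `|X|](subrKA (\sum_(k < N) coef al f k * lagf al k t)).
    apply: le_trans (ler_normD _ _) _; apply: lerD.
      by have := hS N t t0; rewrite (maxn_idPr N0).
    rewrite -sumrB; apply: le_trans (ler_norm_sum _ _ _) _.
    apply: (@le_trans _ _ (\sum_(k < N) e * B)).
      apply: ler_sum => k _; rewrite -mulrBl normrM distrC.
      by apply: ler_pM => //; [exact: ae|exact: hB].
    by rewrite sumr_const card_ord -mulr_natl; lra.
  split.
    by move=> t t0; apply: cvgB; [exact: ch|exact: continuous_sum_lagf].
  move: fh; apply: filterS; first exact: (ae_filter_ringOfSetsType lebesgue_measure).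
  move=> t fh t0; rewrite -fh//= mulrBl mulr_suml; congr (_ - _).
  by apply: eq_bigr => k _; rewrite /lagf mulrA.
exists d, A, B; split=> // [v N|v N delta N0 delta0].
  apply: ge_ereal_sup => _ [f fW <-].
  have h0 k : (k < N.+1)%N -> `|coef al f k - coef al f k| <= 0 by rewrite subrr normr0.
  by have := approx v N.+1 f (coef al f) 0 fW isT h0; rewrite mulr0 addr0.
pose psi (a : nat -> R) t := \sum_(k < N) a k * ell al k t.
pose Om : {fset nat} := [fset k in iota 0 N]%fset.
apply: (@le_trans _ _ (err al v s mu p delta psi Om)).
  apply: ereal_inf_lbound; exists psi, Om; split => //.
    move=> a _ t _; rewrite (_ : psi a =
      horner (\sum_(k < N) a k *: (lagnorm al k *: lagp al k))); first exact: continuous_horner.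
    apply/funext => u; rewrite horner_sum; apply: eq_bigr => k _.
    by rewrite !hornerZ ellE.
  by rewrite card_fseq (leq_trans (size_undup _))// size_iota.
apply: ge_ereal_sup => _ [f fW <-]; apply: ge_ereal_sup => _ [fd [fd2 fdf] <-].
have -> : psi (Ginfo al Om fd) = fun t => \sum_(k < N) coef al fd k * ell al k t.
  apply/funext => t; apply: eq_bigr => k _; rewrite /Ginfo ifT//.
  by rewrite /Om !inE /= mem_iota/= add0n ltn_ord.
by apply: approx => // k _; exact: (le_lnorm k p1 fdf).
Qed.

End UpperBounds.

(** * The threshold *)

Section Threshold.
Context {R : realType}.
Variables (al mu : R) (s p v : \bar R).
Hypotheses (al0 : 0 <= al) (s1 : (1 <= s)%E) (p1 : (1 <= p)%E) (mu0 : 0 < mu).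

Lemma ereal_pinfty_of_lower (x : \bar R) (e c : R) N : 0 < e -> 0 < c ->
  (forall M : nat, (N < M)%N -> ((c * M%:R `^ e)%:E <= x)%E) -> x = +oo%E.
Proof.
move=> e0 c0 h; apply: eq_infty => A.
have [M NM AM] := powR_unbounded A N e0 c0.
by apply: le_trans (h M NM); rewrite lee_fin.
Qed.

Lemma eps_eq_pinfty N : mu < 1 - recip s -> (0 < N)%N -> eps al v s mu N = +oo%E.
Proof.
move=> smu N0; have e0 : 0 < - mu - recip s + 1 by lra.
apply: (@ereal_pinfty_of_lower _ _ (2 `^ (- mu) * cbar al) N e0).
  by rewrite mulr_gt0 ?powR_gt0// cbar_gt0.
move=> M NM; apply: le_trans (eps_ge_f1 al0 v s1 mu0 N0 NM).
exact: (f1_lower al0 s mu (leq_ltn_trans (leq0n N) NM)).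
Qed.

Lemma eps_ge_critical N : mu = 1 - recip s -> (0 < N)%N ->
  ((2 `^ (- mu) * cbar al)%:E <= eps al v s mu N)%E.
Proof.
move=> smu N0; apply: le_trans (eps_ge_f1 al0 v s1 mu0 N0 (leqnn N.+1)).
have := f1_lower al0 s mu (ltn0Sn N).
by rewrite (_ : - mu - recip s + 1 = 0) ?powRr0 ?mulr1//; lra.
Qed.

Lemma Rmin_eq_pinfty N (delta : R) : mu < 1 - recip s -> (0 < N)%N -> 0 < delta ->
  Rmin al v s mu p N delta = +oo%E.
Proof.
move=> smu N0 d0; have e0 : 0 < - mu - recip s + 1 by lra.
apply: (@ereal_pinfty_of_lower _ _ (recovery_cst al mu) N e0); first exact: recovery_cst_gt0.
by move=> M NM; apply: Rmin_lower => //; exact: ltnW.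
Qed.

Lemma Rmin_ge_critical N (delta : R) : mu = 1 - recip s -> (0 < N)%N -> 0 < delta ->
  ((recovery_cst al mu)%:E <= Rmin al v s mu p N delta)%E.
Proof.
move=> smu N0 d0; have := Rmin_lower al0 v s1 p1 mu0 N0 (leqnn N) d0.
by rewrite (_ : - mu - recip s + 1 = 0) ?powRr0 ?mulr1//; lra.
Qed.

Lemma eps_not_cvg0 : mu = 1 - recip s -> ~ (eps al v s mu N @[N --> \oo] --> 0%E).
Proof.
move=> smu h; have c0 : 0 < 2 `^ (- mu) * cbar al by rewrite mulr_gt0 ?powR_gt0 ?cbar_gt0.
have : ((2 `^ (- mu) * cbar al)%:E <= 0)%E.
  rewrite -(cvg_lim _ h)//; apply: lime_ge; first by apply/cvg_ex; exists 0%E.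
  by near=> N; apply: eps_ge_critical => //; near: N; exact: nbhs_infty_gt.
by rewrite lee_fin leNgt c0.
Unshelve. all: end_near. Qed.

Local Notation Rinf delta :=
  (ereal_inf [set Rmin al v s mu p N delta | N in [set N | (1 <= N)%N]]).

(** For fixed N the upper bound keeps the truncation term A N^(-d). So N is chosen first, to make
    this term at most e/2, and delta afterwards, small compared with 1/N. *)
Lemma Rinf_cvg0 : 1 - recip s < mu -> Rinf delta @[delta --> (0 : R)^'+] --> 0%E.
Proof.
move=> smu; have [d [A [B [d0 A0 B0 _ hR]]]] := recovery_bounds al0 s1 p1 mu0 smu.
have small (e : R) : 0 < e -> exists2 r : R, 0 < r &
    forall delta, 0 < delta -> delta < r -> (Rinf delta <= e%:E)%E.
  move=> e0; have eA : 0 < e / 2 / A by rewrite !divr_gt0.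
  have [N0 _ hN0] := cvgr_lt _ (cvg_maxn1_powRN d0) _ eA.
  pose N := N0.+1; have N1 : (0 < N)%N by [].
  have hN := hN0 N (leqnSn _); rewrite /= (maxn_idPr N1) in hN.
  have BN : 0 < B * N%:R by rewrite mulr_gt0// ltr0n.
  exists (e / 2 / (B * N%:R)); first by rewrite !divr_gt0.
  move=> delta delta0 hd.
  apply: (@le_trans _ _ (Rmin al v s mu p N delta)).
    by apply: ereal_inf_lbound; exists N.
  apply: (le_trans (hR v N delta N1 delta0)); rewrite lee_fin.
  have h1 : A * N%:R `^ (- d) <= e / 2 by rewrite mulrC -ler_pdivlMr// ltW.
  have h2 : B * N%:R * delta <= e / 2 by rewrite mulrC -ler_pdivlMr// ltW.
  lra.
have ge0 delta : 0 < delta -> (0 <= Rinf delta)%E.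
  move=> delta0; apply: le_ereal_inf_tmp => _ [N N1 <-].
  exact: Rmin_ge0.
apply/fine_cvgP; split.
  have [r r0 hr] := small 1 ltr01.
  near=> delta.
  have delta0 : 0 < delta by near: delta; exact: nbhs_right_gt.
  rewrite ge0_fin_numE ?ge0//; apply: le_lt_trans (hr delta delta0 _) (ltry _).
  by near: delta; exact: nbhs_right_lt.
apply/cvgrPdist_le => e e0; have [r r0 hr] := small e e0.
near=> delta.
have delta0 : 0 < delta by near: delta; exact: nbhs_right_gt.
have hd : (Rinf delta <= e%:E)%E.
  by apply: hr => //; near: delta; exact: nbhs_right_lt.
rewrite sub0r normrN /= ger0_norm ?fine_ge0 ?ge0//.
rewrite -lee_fin fineK// ge0_fin_numE ?ge0//.
exact: le_lt_trans hd (ltry _).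
Unshelve. all: end_near. Qed.

(** The two assumptions exclude different cases: equality contradicts the convergence, since the
    error then has a lower bound independent of N and delta, and a smaller mu contradicts
    finiteness. *)
Lemma threshold_of_cvg0 :
  (forall (N : nat) (delta : R), (1 <= N)%N -> 0 < delta < 1 ->
    (Rmin al v s mu p N delta < +oo)%E) ->
  Rinf delta @[delta --> (0 : R)^'+] --> 0%E -> 1 - recip s < mu.
Proof.
move=> fin cvg0; rewrite ltNge le_eqVlt; apply/negP => /predU1P[smu|smu].
  have : ((recovery_cst al mu)%:E <= 0)%E.
    rewrite -(cvg_lim _ cvg0)//; apply: lime_ge; first by apply/cvg_ex; exists 0%E.
    near=> delta.
    have delta0 : 0 < delta by near: delta; exact: nbhs_right_gt.
    by apply: le_ereal_inf_tmp => _ [N N1 <-]; exact: Rmin_ge_critical.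
  by rewrite lee_fin leNgt recovery_cst_gt0.
have gt0 : 0 < 2^-1 :> R by rewrite invr_gt0 ltr0n.
have lt1 : 2^-1 < 1 :> R by rewrite invf_lt1 ?ltr1n ?ltr0n.
have := fin 1%N 2^-1 isT; rewrite gt0 lt1 => /(_ isT).
by rewrite Rmin_eq_pinfty// ltxx.
Unshelve. all: end_near. Qed.

End Threshold.

Theorem mainTheorem6 (R : realType) (alpha mu : R) (s p v : \bar R)
    (alpha_ge0 : 0 <= alpha) (s_ge1 : (1 <= s)%E) (p_ge1 : (1 <= p)%E)
    (mu_gt0 : 0 < mu) (v_ge0 : (0 <= v)%E) :
  (* (a) *)
  [/\ forall N M : nat, (1 <= N)%N -> (N < M)%N ->
        (normC (f1 alpha s mu M \* sqrtw alpha)%R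
           <= eps alpha v s mu N)%E /\
        ((2 `^ (- mu) * cbar alpha * M%:R `^ (- mu - recip s + 1))%:E
           <= normC (f1 alpha s mu M \* sqrtw alpha)%R)%E,
      mu < 1 - recip s ->
        forall N : nat, (1 <= N)%N -> eps alpha v s mu N = +oo%E
    & mu = 1 - recip s ->
        [/\ 0 < 2 `^ (- mu) * cbar alpha,
            forall N : nat, (1 <= N)%N ->
              ((2 `^ (- mu) * cbar alpha)%:E <= eps alpha v s mu N)%E
          & ~ (eps alpha v s mu N @[N --> \oo] --> 0%E)]] /\
  (* (b) *)
  [/\ exists2 c : R, 0 < c &
        forall (N M : nat) (delta : R), (1 <= N)%N -> 0 < delta < 1 ->
          (N <= M)%N ->
          ((c * M%:R `^ (- mu - recip s + 1))%:E
             <= Rmin alpha v s mu p N delta)%E,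
      mu < 1 - recip s ->
        forall (N : nat) (delta : R), (1 <= N)%N -> 0 < delta < 1 ->
          Rmin alpha v s mu p N delta = +oo%E
    & mu = 1 - recip s ->
        exists2 c : R, 0 < c &
          forall (N : nat) (delta : R), (1 <= N)%N -> 0 < delta < 1 ->
            (c%:E <= Rmin alpha v s mu p N delta)%E] /\
  (* the threshold mu > 1 - 1/s *)
  (1 - recip s < mu ->
     forall N : nat, (1 <= N)%N -> (eps alpha v s mu N < +oo)%E) /\
  ((forall (N : nat) (delta : R), (1 <= N)%N -> 0 < delta < 1 ->
      (Rmin alpha v s mu p N delta < +oo)%E) /\
   (ereal_inf [set Rmin alpha v s mu p N delta | N in [set N | (1 <= N)%N]]
      @[delta --> (0 : R)^'+] --> 0%E)
   <-> 1 - recip s < mu).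
Proof.
split; [split|split; [split|split]].
- move=> N M N1 NM; split; first exact: eps_ge_f1.
  by apply: f1_lower => //; exact: leq_ltn_trans NM.
- by move=> smu N N1; exact: eps_eq_pinfty.
- move=> smu; split; [|by move=> N N1; exact: eps_ge_critical|exact: eps_not_cvg0].
  by rewrite mulr_gt0 ?powR_gt0// cbar_gt0.
- exists (recovery_cst alpha mu); first exact: recovery_cst_gt0.
  by move=> N M delta N1 /andP[d0 _] NM; exact: Rmin_lower.
- by move=> smu N delta N1 /andP[d0 _]; exact: Rmin_eq_pinfty.
- move=> smu; exists (recovery_cst alpha mu); first exact: recovery_cst_gt0.
  by move=> N delta N1 /andP[d0 _]; exact: Rmin_ge_critical.
- move=> smu N N1.
  have [d [A [B [_ _ _ hE _]]]] := recovery_bounds alpha_ge0 s_ge1 p_ge1 mu_gt0 smu.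
  exact: le_lt_trans (hE v N) (ltry _).
- split=> [[fin cvg0]|smu]; first exact: threshold_of_cvg0 fin cvg0.
  split; last exact: Rinf_cvg0.
  move=> N delta N1 /andP[delta0 _].
  have [d [A [B [_ _ _ _ hR]]]] := recovery_bounds alpha_ge0 s_ge1 p_ge1 mu_gt0 smu.
  exact: le_lt_trans (hR v N delta N1 delta0) (ltry _).
Qed.
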